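(* Let $G$ be a finitely generated non-elementary Morse group and let $X$ be its Cayley graph with respect to a fixed finite generating set, with basepoint $x_0$. The following are equivalent: (1) $G$ is hyperbolic. (2) $\partial_M X$ is compact. (3) The Morse gauges are uniform, i.e. $\partial_M X_{x_0}\subset\partial_M^N X_{x_0}$ for some Morse gauge $N$. (4) For some point $p\in\partial_M X_{x_0}$, the orbit $Gp$ is contained in $\partial_M^N X_{x_0}$ for some Morse gauge $N$. (5) Geodesic segments in $X$ are uniformly Morse, i.e. there is a Morse gauge $N$ such that every geodesic segment in $X$ is $N$-Morse. (6) Geodesic rays in $X$ are uniformly Morse, i.e. there is a Morse gauge $N$ such that every geodesic ray in $X$ is $N$-Morse.
   Context: A Morse gauge is a function $N:[1,\infty)\times[0,\infty)\to[0,\infty)$; a (quasi-)geodesic $\gamma$ is $N$-Morse if every $(\lambda,\epsilon)$-quasi-geodesic with endpoints on $\gamma$ lies in the $N(\lambda,\epsilon)$-neighborhood of $\gamma$. The Morse boundary $\partial_M X_{x_0}$ is the set of classes of Morse geodesic rays based at $x_0$ modulo finite Hausdorff distance; $\partial_M^N X_{x_0}$ is the subset of classes containing an $N$-Morse ray based at $x_0$, with the quotient of the compact-open topology, and $\partial_M X_{x_0}=\varinjlim_N\partial_M^N X_{x_0}$ (gauges ordered pointwise) with the direct limit topology. $G$ acts on $\partial_M X$ by $[\alpha]\mapsto[g\circ\alpha]$. $G$ is non-elementary Morse if $\partial_M X$ is nonempty and $G$ is not virtually cyclic. *)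

(* Defs.v *)
From Stdlib Require Import Reals List ZArith.
From Coquelicot Require Import Coquelicot.
Open Scope R_scope.

Record group := Group {
  gcar :> Type;
  gmul : gcar -> gcar -> gcar;
  ginv : gcar -> gcar;
  gone : gcar;
  gmulA : forall a b c, gmul a (gmul b c) = gmul (gmul a b) c;
  gmul1 : forall a, gmul gone a = a;
  gmulV : forall a, gmul (ginv a) a = gone }.
Arguments gmul {g}. Arguments ginv {g}. Arguments gone {g}.

Fixpoint gnpow {G : group} (c : G) (n : nat) : G :=
  match n with O => gone | S n => gmul c (gnpow c n) end.
Definition gzpow {G : group} (c : G) (z : Z) : G :=
  match z with
  | Z0 => gone
  | Zpos p => gnpow c (Pos.to_nat p)
  | Zneg p => ginv (gnpow c (Pos.to_nat p))
  end.

Definition virtually_cyclic (G : group) : Prop :=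
  exists (c : G) (reps : list G), forall g : G,
    exists r n, In r reps /\ g = gmul r (gzpow c n).

Section Cayley.
Variable G : group.
Variable S : list G.

(** letters: nontrivial elements of S and their inverses (no loops) *)
Definition gen_letter (s : G) : Prop := s <> gone /\ (In s S \/ In (ginv s) S).

Fixpoint wprod (w : list G) : G :=
  match w with nil => gone | s :: w => gmul s (wprod w) end.

Definition generates : Prop :=
  forall g : G, exists w, List.Forall gen_letter w /\ wprod w = g.

Definition word_dist (g h : G) : R :=
  real (Glb_Rbar (fun r => exists w, List.Forall gen_letter w /\
                     gmul g (wprod w) = h /\ r = INR (length w))).

(** Points of the Cayley graph (metric graph, edges of length 1):
    the point at distance t from g on the edge {g, g s}. *)
Record cpoint := CPoint {
  cp_base : G; cp_gen : G; cp_t : R;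
  cp_gen_ok : gen_letter cp_gen; cp_t_ok : 0 <= cp_t <= 1 }.

Definition cp_ends (p : cpoint) : list (G * R) :=
  (cp_base p, cp_t p) :: (gmul (cp_base p) (cp_gen p), 1 - cp_t p) :: nil.

(** path (pseudo)metric of the Cayley graph *)
Definition dX (p q : cpoint) : R :=
  real (Glb_Rbar (fun r =>
    (exists a b, In a (cp_ends p) /\ In b (cp_ends q) /\
                 r = snd a + word_dist (fst a) (fst b) + snd b)
    \/ (cp_base p = cp_base q /\ cp_gen p = cp_gen q /\ r = Rabs (cp_t p - cp_t q))
    \/ (cp_base p = gmul (cp_base q) (cp_gen q) /\ gmul (cp_base p) (cp_gen p) = cp_base q
        /\ r = Rabs (cp_t p - (1 - cp_t q))))).

Definition is_vertex (g : G) (p : cpoint) : Prop :=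
  (cp_base p = g /\ cp_t p = 0) \/ (gmul (cp_base p) (cp_gen p) = g /\ cp_t p = 1).

Definition translate (g : G) (p : cpoint) : cpoint :=
  CPoint (gmul g (cp_base p)) (cp_gen p) (cp_t p) (cp_gen_ok p) (cp_t_ok p).

Definition quasi_geodesic (lam eps : R) (q : R -> cpoint) (a b : R) : Prop :=
  forall s t, a <= s <= b -> a <= t <= b ->
    (1 / lam) * Rabs (s - t) - eps <= dX (q s) (q t) <= lam * Rabs (s - t) + eps.

Definition geodesic_on (J : R -> Prop) (g : R -> cpoint) : Prop :=
  forall s t, J s -> J t -> dX (g s) (g t) = Rabs (s - t).

Definition seg_dom (L : R) (s : R) : Prop := 0 <= s <= L.
Definition ray_dom (s : R) : Prop := 0 <= s.

Definition geodesic_segment (L : R) (g : R -> cpoint) : Prop :=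
  0 <= L /\ geodesic_on (seg_dom L) g.
Definition geodesic_ray (g : R -> cpoint) : Prop := geodesic_on ray_dom g.

Definition morse_gauge (N : R -> R -> R) : Prop :=
  forall lam eps, 1 <= lam -> 0 <= eps -> 0 <= N lam eps.

Definition is_N_Morse (N : R -> R -> R) (J : R -> Prop) (g : R -> cpoint) : Prop :=
  forall lam eps (q : R -> cpoint) a b s t,
    1 <= lam -> 0 <= eps -> a <= b -> quasi_geodesic lam eps q a b ->
    J s -> J t -> dX (q a) (g s) = 0 -> dX (q b) (g t) = 0 ->
    forall u, a <= u <= b -> exists v, J v /\ dX (q u) (g v) <= N lam eps.

Definition based_at (x : G) (g : R -> cpoint) : Prop :=
  exists p, is_vertex x p /\ dX (g 0) p = 0.

Definition N_ray (N : R -> R -> R) (g : R -> cpoint) : Prop :=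
  geodesic_ray g /\ based_at gone g /\ is_N_Morse N ray_dom g.
Definition Morse_ray (g : R -> cpoint) : Prop :=
  exists N, morse_gauge N /\ N_ray N g.

Definition fin_hausdorff (g h : R -> cpoint) : Prop :=
  exists K, (forall s, 0 <= s -> exists t, 0 <= t /\ dX (g s) (h t) <= K)
         /\ (forall t, 0 <= t -> exists s, 0 <= s /\ dX (g s) (h t) <= K).

Definition mclass (g : R -> cpoint) : (R -> cpoint) -> Prop :=
  fun h => Morse_ray h /\ fin_hausdorff g h.
Definition bdry (C : (R -> cpoint) -> Prop) : Prop :=
  exists g, Morse_ray g /\ C = mclass g.
Definition bdryN (N : R -> R -> R) (C : (R -> cpoint) -> Prop) : Prop :=
  bdry C /\ exists g, C g /\ N_ray N g.

(** compact-open (= uniform convergence on compacta) topology on N-Morse rays *)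
Definition open_rays (N : R -> R -> R) (O : (R -> cpoint) -> Prop) : Prop :=
  forall g, N_ray N g -> O g -> exists T del, 0 < del /\
    forall h, N_ray N h -> (forall s, 0 <= s <= T -> dX (g s) (h s) < del) -> O h.

(** direct limit topology on the Morse boundary *)
Definition bdry_open (U : ((R -> cpoint) -> Prop) -> Prop) : Prop :=
  forall N, morse_gauge N -> open_rays N (fun g => N_ray N g /\ U (mclass g)).

Definition bdry_compact : Prop :=
  forall (I : Type) (Us : I -> ((R -> cpoint) -> Prop) -> Prop),
    (forall i, bdry_open (Us i)) ->
    (forall C, bdry C -> exists i, Us i C) ->
    exists l : list I, forall C, bdry C -> exists i, In i l /\ Us i C.

Definition bdry_act (g : G) (C : (R -> cpoint) -> Prop) : (R -> cpoint) -> Prop :=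
  fun h => Morse_ray h /\ exists a, C a /\ fin_hausdorff (fun s => translate g (a s)) h.

Definition cayley_hyperbolic : Prop :=
  exists delta, 0 <= delta /\
   forall (x y z : cpoint) L1 L2 L3 (al be ga : R -> cpoint),
     geodesic_segment L1 al -> geodesic_segment L2 be -> geodesic_segment L3 ga ->
     dX (al 0) x = 0 -> dX (al L1) y = 0 ->
     dX (be 0) y = 0 -> dX (be L2) z = 0 ->
     dX (ga 0) x = 0 -> dX (ga L3) z = 0 ->
     forall u, 0 <= u <= L1 -> exists v,
       (0 <= v <= L2 /\ dX (al u) (be v) <= delta) \/
       (0 <= v <= L3 /\ dX (al u) (ga v) <= delta).

Definition nonelementary_morse : Prop :=
  (exists C, bdry C) /\ ~ virtually_cyclic G.

End Cayley.

Definition hyperbolic_group (G : group) : Prop :=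
  exists S : list G, generates G S /\ cayley_hyperbolic G S.

(* Main.v *)
(** Everything goes through one property of the Cayley graph: any two
    [(lam, eps)]-quasi-geodesics with the same endpoints stay within a distance
    [D(lam, eps)] of each other. It is equivalent to (5), it follows from
    hyperbolicity by the stability of quasi-geodesics, and it passes between word
    metrics of different generating sets because they are quasi-isometric.

    The key implication is from (4). A uniformly Morse orbit [Gp] provides, by
    translation, uniformly Morse rays [al], [be] towards [p] from any two vertices
    [x], [y]. These merge near the point [m] of [al] nearest to [y], and every
    quasi-geodesic from [x] to [y] passes near [m]: projecting [m] to it
    produces quasi-geodesics from [x] and from [y] to [m], which are controlled by
    [al] and by [be]. The two halves of two such quasi-geodesics are then
    uniformly close since their endpoints are on a common Morse ray.

    For compactness, (3) makes the boundary a quotient of the space of [N]-Morse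
    rays at a vertex, which is compact by Koenig's lemma. If conversely the
    gauges are not uniform, some [(lam, eps)] has unbounded constants, and a
    sequence of classes whose constants tend to infinity is an infinite closed
    discrete subset. *)

Require Import Defs.
From Stdlib Require Import Reals List Lra Lia Psatz Classical ClassicalEpsilon.
From Stdlib Require Import FunctionalExtensionality PropExtensionality.
From Coquelicot Require Import Coquelicot.
Open Scope R_scope.

(** * Quasi-geodesics and Morse rays in pseudometric spaces *)

(** Two features of the objects shape the proof. Quasi-geodesics need not be continuous: nearest
    points on them exist only up to an additive 1, and the intermediate value theorem is replaced by
    one for relations with bounded jumps. Points of the Cayley graph have several representations at
    distance 0 from each other: the metric arguments are made in pseudometric spaces, with saturated
    images in place of paths.

    New quasi-geodesics come from one kind of surgery: follow a [(lam, eps)]-quasi-geodesic up to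
    its point m nearest to p, then a geodesic from m to p. The result is a
    [(3 * lam, eps + 1)]-quasi-geodesic. One surgery on a geodesic gives the arguments of [N 3 1],
    two give those of [N 9 2].

    Asymptotic rays come with a constant K over which there is no control. It is eliminated by doing
    the surgery so far out, depending on K, that the part of the path under study survives it; the
    bounds then depend only on the gauge and, at most, on the distance of the starting points. *)

Definition pseudometric {X : Type} (d : X -> X -> R) : Prop :=
  (forall x, d x x = 0) /\ (forall x y, d x y = d y x) /\
  (forall x y z, d x z <= d x y + d y z).

Definition qg {X : Type} (d : X -> X -> R) (lam eps : R) (q : R -> X) (a b : R) : Prop :=
  forall s t, a <= s <= b -> a <= t <= b ->
    (1 / lam) * Rabs (s - t) - eps <= d (q s) (q t) <= lam * Rabs (s - t) + eps.

(** Images are saturated under [d = 0], so that they only depend on the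
    underlying path in the metric quotient and contain both endpoints. *)
Definition image {X : Type} (d : X -> X -> R) (q : R -> X) (a b : R) (z : X) : Prop :=
  exists u, a <= u <= b /\ d (q u) z = 0.

Definition qpath {X : Type} (d : X -> X -> R) (lam eps : R) (x y : X) (A : X -> Prop) : Prop :=
  exists q a b, a <= b /\ qg d lam eps q a b /\ d (q a) x = 0 /\ d (q b) y = 0 /\
    forall z, A z <-> image d q a b z.

Definition shadow {X : Type} (d : X -> X -> R) (D : R) (A B : X -> Prop) : Prop :=
  forall z, A z -> exists z', B z' /\ d z z' <= D.

(** One-sided shadowing suffices: exchanging [A] and [B] gives the other inclusion. *)
Definition stable {X : Type} (d : X -> X -> R) (lam eps D : R) (x y : X) : Prop :=
  forall A B, qpath d lam eps x y A -> qpath d lam eps x y B -> shadow d D A B.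

Definition qg_stable {X : Type} (d : X -> X -> R) : Prop :=
  forall lam eps, 1 <= lam -> 0 <= eps -> exists D, forall x y, stable d lam eps D x y.

Definition geodesic_space {X : Type} (d : X -> X -> R) : Prop :=
  forall x y, exists T, qpath d 1 0 x y T.

Definition isom_on {X : Type} (d : X -> X -> R) (J : R -> Prop) (g : R -> X) : Prop :=
  forall s t, J s -> J t -> d (g s) (g t) = Rabs (s - t).

Definition Morse {X : Type} (d : X -> X -> R) (N : R -> R -> R) (J : R -> Prop) (g : R -> X) : Prop :=
  forall lam eps (q : R -> X) a b s t,
    1 <= lam -> 0 <= eps -> a <= b -> qg d lam eps q a b ->
    J s -> J t -> d (q a) (g s) = 0 -> d (q b) (g t) = 0 ->
    forall u, a <= u <= b -> exists v, J v /\ d (q u) (g v) <= N lam eps.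

Definition ray (s : R) : Prop := 0 <= s.

(** Only one inclusion is required; for geodesic rays it already gives finite Hausdorff distance. *)
Definition asymptotic {X : Type} (d : X -> X -> R) (g h : R -> X) : Prop :=
  exists K, forall s, 0 <= s -> exists t, 0 <= t /\ d (g s) (h t) <= K.

(** The slack 1 is there because the image of a discontinuous quasi-geodesic may contain no closest
    point. *)
Definition nearest {X : Type} (d : X -> X -> R) (p m : X) (A : X -> Prop) : Prop :=
  A m /\ forall z, A z -> d p m <= d p z + 1.

Definition thin_triangles {X : Type} (d : X -> X -> R) (delta : R) : Prop :=
  forall x y z A B C, qpath d 1 0 x y A -> qpath d 1 0 y z B -> qpath d 1 0 x z C ->
    forall w, A w -> exists v, (B v \/ C v) /\ d w v <= delta.

Ltac rabs := repeat match goal with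
  | |- context [Rabs ?x] => unfold Rabs at 1; destruct (Rcase_abs x)
  | H : context [Rabs ?x] |- _ => unfold Rabs in H at 1; destruct (Rcase_abs x) end.

Lemma functional_choice {A B : Type} (P : A -> B -> Prop) :
  (forall x, exists y, P x y) -> exists f, forall x, P x (f x).
Proof.
  intro H. exists (fun x => proj1_sig (constructive_indefinite_description _ (H x))).
  intro x. apply proj2_sig.
Qed.

(** A discrete intermediate value theorem: walking from [a] to [b] in steps of length at most 1, the
    partner [v] moves by at most [C] per step, so it is within [C] of [m] when it passes [m]. In the
    applications [P] relates parameters of two paths that are close to each other. *)
Lemma relational_ivt (P : R -> R -> Prop) (C a b va vb m : R) :
  0 <= C -> a <= b ->
  (forall u, a <= u <= b -> exists v, P u v) ->
  (forall u u' v v', a <= u <= b -> a <= u' <= b -> P u v -> P u' v' ->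
     Rabs (u - u') <= 1 -> Rabs (v - v') <= C) ->
  P a va -> P b vb -> (va <= m <= vb \/ vb <= m <= va) ->
  exists u v, a <= u <= b /\ P u v /\ Rabs (v - m) <= C.
Proof.
  intros HC Hab Htot Hjump Ha Hb Hm.
  destruct (INR_unbounded (b - a)) as [n Hn].
  revert a va Hab Htot Hjump Ha Hm Hn.
  induction n as [|n IH]; intros a va Hab Htot Hjump Ha Hm Hn.
  - simpl in Hn; lra.
  - destruct (Rle_dec (b - a) 1) as [Hs|Hs].
    + exists a, va. split; [lra|split; [assumption|]].
      assert (Rabs (va - vb) <= C).
      { apply (Hjump a b); try assumption; try lra. rabs; lra. }
      revert H; rabs; lra.
    + destruct (Htot (a + 1)) as [w Hw]; [lra|].
      assert (Hj : Rabs (va - w) <= C).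
      { apply (Hjump a (a + 1)); try assumption; try lra. rabs; lra. }
      destruct (classic (w <= m <= vb \/ vb <= m <= w)) as [Hw'|Hw'].
      * destruct (IH (a + 1) w) as (u & v & Hu & HP & Hv); try assumption; try lra.
        -- intros; apply Htot; lra.
        -- intros; apply (Hjump u u'); try assumption; lra.
        -- rewrite S_INR in Hn; lra.
        -- exists u, v; split; [lra|auto].
      * exists a, va. split; [lra|split; [assumption|]].
        revert Hj; rabs; lra.
Qed.

Section Pseudometric.
Context {X : Type} {d : X -> X -> R}.
Hypothesis pm : pseudometric d.

Lemma pd_refl (x : X) : d x x = 0.
Proof. apply pm. Qed.
Lemma pd_sym (x y : X) : d x y = d y x.
Proof. apply pm. Qed.
Lemma pd_tri (x y z : X) : d x z <= d x y + d y z.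
Proof. apply pm. Qed.
Lemma pd_ge0 (x y : X) : 0 <= d x y.
Proof.
  pose proof (pd_tri x y x). rewrite pd_refl, (pd_sym y x) in H. lra.
Qed.
Lemma pd_eq0_l (x y z : X) : d x y = 0 -> d x z = d y z.
Proof.
  intro H. pose proof (pd_tri x y z). pose proof (pd_tri y x z).
  rewrite (pd_sym y x) in H1. lra.
Qed.
Lemma pd_eq0_r (x y z : X) : d x y = 0 -> d z x = d z y.
Proof. intro H. rewrite (pd_sym z x), (pd_sym z y). now apply pd_eq0_l. Qed.

(** A point that fails to be nearest can be replaced by one closer to [p] by more than 1; as
    distances are nonnegative, this stops. *)
Lemma nearest_exists (p : X) (A : X -> Prop) : (exists z, A z) -> exists m, nearest d p m A.
Proof.
  intros [z0 Hz0].
  destruct (INR_unbounded (d p z0)) as [n Hn].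
  revert z0 Hz0 Hn. induction n as [|n IH]; intros z0 Hz0 Hn.
  - simpl in Hn. pose proof (pd_ge0 p z0). lra.
  - destruct (classic (exists z, A z /\ d p z + 1 < d p z0)) as [(z & Hz & Hlt)|Hno].
    + apply (IH z Hz). rewrite S_INR in Hn. lra.
    + exists z0. split; [assumption|]. intros z Hz.
      destruct (Rle_dec (d p z0) (d p z + 1)); [assumption|].
      exfalso; apply Hno; exists z; split; [assumption|lra].
Qed.

(** * Restricting, reversing, splitting, moving and joining quasi-geodesics *)

Lemma isom_qg (J : R -> Prop) (g : R -> X) (a b : R) :
  isom_on d J g -> (forall u, a <= u <= b -> J u) -> qg d 1 0 g a b.
Proof.
  intros Hg HJ s t Hs Ht. rewrite Hg by auto. lra.
Qed.

Lemma qg_geodesic (g : R -> X) (a b : R) : qg d 1 0 g a b -> isom_on d (fun u => a <= u <= b) g.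
Proof. intros Hg s t Hs Ht. specialize (Hg s t Hs Ht). lra. Qed.

Lemma qg_weaken (lam eps lam' eps' : R) q a b :
  1 <= lam <= lam' -> eps <= eps' -> qg d lam eps q a b -> qg d lam' eps' q a b.
Proof.
  intros Hl He H s t Hs Ht. destruct (H s t Hs Ht) as [H1 H2].
  pose proof (Rabs_pos (s - t)).
  assert (1 / lam' <= 1 / lam).
  { unfold Rdiv. rewrite !Rmult_1_l. apply Rinv_le_contravar; lra. }
  split; nra.
Qed.

Lemma qg_sub (lam eps : R) q a b a' b' :
  a <= a' -> b' <= b -> qg d lam eps q a b -> qg d lam eps q a' b'.
Proof. intros H1 H2 H s t Hs Ht. apply H; lra. Qed.

Lemma qg_lower (lam eps : R) q a b s t : 1 <= lam -> qg d lam eps q a b ->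
  a <= s <= b -> a <= t <= b -> Rabs (s - t) <= lam * (d (q s) (q t) + eps).
Proof.
  intros Hl H Hs Ht. destruct (H s t Hs Ht) as [H1 _].
  assert (E : Rabs (s - t) = lam * ((1 / lam) * Rabs (s - t))) by (field; lra).
  rewrite E. apply Rmult_le_compat_l; lra.
Qed.

Lemma qg_of_bounds (lam eps : R) q a b : 1 <= lam ->
  (forall s t, a <= s <= t -> t <= b ->
     t - s <= lam * (d (q s) (q t) + eps) /\ d (q s) (q t) <= lam * (t - s) + eps) ->
  qg d lam eps q a b.
Proof.
  intros Hl H.
  assert (G : forall s t, a <= s <= t -> t <= b ->
    (1 / lam) * Rabs (s - t) - eps <= d (q s) (q t) <= lam * Rabs (s - t) + eps).
  { intros s t H1 H2. destruct (H s t H1 H2) as [H3 H4].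
    replace (Rabs (s - t)) with (t - s) by (rabs; lra).
    split; [|assumption].
    assert ((1 / lam) * (t - s) <= (1 / lam) * (lam * (d (q s) (q t) + eps))).
    { apply Rmult_le_compat_l; [|assumption]. apply Rlt_le, Rdiv_lt_0_compat; lra. }
    assert ((1 / lam) * (lam * (d (q s) (q t) + eps)) = d (q s) (q t) + eps) by (field; lra).
    lra. }
  intros s t Hs Ht. destruct (Rle_dec s t).
  - apply G; lra.
  - rewrite Rabs_minus_sym, pd_sym. apply G; lra.
Qed.

Lemma qpath_of_qg (lam eps : R) q a b : a <= b -> qg d lam eps q a b ->
  qpath d lam eps (q a) (q b) (image d q a b).
Proof.
  intros Hab H. exists q, a, b. auto 10 using pd_refl, iff_refl.
Qed.

Lemma qpath_ends (lam eps : R) x y A : qpath d lam eps x y A -> A x /\ A y.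
Proof.
  intros (q & a & b & Hab & Hq & Hx & Hy & HA). split; apply HA.
  - exists a; split; [lra|assumption].
  - exists b; split; [lra|assumption].
Qed.

Lemma qpath_endpoints (lam eps : R) x y x' y' A :
  qpath d lam eps x y A -> d x x' = 0 -> d y y' = 0 -> qpath d lam eps x' y' A.
Proof.
  intros (q & a & b & Hab & Hq & Hx & Hy & HA) Ex Ey.
  exists q, a, b. split; [assumption|split; [assumption|split; [|split; [|assumption]]]].
  - rewrite <- (pd_eq0_r _ _ _ Ex); assumption.
  - rewrite <- (pd_eq0_r _ _ _ Ey); assumption.
Qed.

Lemma qpath_sym (lam eps : R) x y A : qpath d lam eps x y A -> qpath d lam eps y x A.
Proof.
  intros (q & a & b & Hab & Hq & Hx & Hy & HA).
  exists (fun u => q (- u)), (- b), (- a). split; [lra|]. split.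
  - intros s t Hs Ht. replace (s - t) with (- (- s - - t)) by lra. rewrite Rabs_Ropp.
    apply Hq; lra.
  - rewrite !Ropp_involutive. repeat split; auto.
    + intro Hz. apply HA in Hz. destruct Hz as (u & Hu & Hz). exists (- u).
      rewrite Ropp_involutive. split; [lra|assumption].
    + intros (u & Hu & Hz). apply HA. exists (- u). split; [lra|assumption].
Qed.

Lemma qpath_weaken (lam eps lam' eps' : R) x y A :
  1 <= lam <= lam' -> eps <= eps' -> qpath d lam eps x y A -> qpath d lam' eps' x y A.
Proof.
  intros Hl He (q & a & b & Hab & Hq & H). exists q, a, b.
  split; [assumption|split; [|assumption]]. eapply qg_weaken; eauto.
Qed.

Lemma qpath_split (lam eps : R) x y A m : qpath d lam eps x y A -> A m ->
  exists A1 A2, qpath d lam eps x m A1 /\ qpath d lam eps m y A2 /\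
    (forall z, A z -> A1 z \/ A2 z) /\ (forall z, A1 z -> A z) /\ (forall z, A2 z -> A z).
Proof.
  intros (q & a & b & Hab & Hq & Hx & Hy & HA) Hm. apply HA in Hm.
  destruct Hm as (u & Hu & Hm).
  exists (image d q a u), (image d q u b). split; [|split; [|split; [|split]]].
  - exists q, a, u. split; [lra|]. split; [eapply qg_sub; eauto; lra|]. auto using iff_refl.
  - exists q, u, b. split; [lra|]. split; [eapply qg_sub; eauto; lra|]. auto using iff_refl.
  - intros z Hz. apply HA in Hz. destruct Hz as (w & Hw & Hz).
    destruct (Rle_dec w u); [left|right]; exists w; split; auto; lra.
  - intros z (w & Hw & Hz). apply HA. exists w; split; [lra|assumption].
  - intros z (w & Hw & Hz). apply HA. exists w; split; [lra|assumption].
Qed.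

Lemma qpath_diam (lam eps : R) x y A z : 1 <= lam -> qpath d lam eps x y A -> A z ->
  d z y <= lam * (lam * (d x y + eps)) + eps.
Proof.
  intros Hl (q & a & b & Hab & Hq & Hx & Hy & HA) Hz. apply HA in Hz.
  destruct Hz as (u & Hu & Hz).
  rewrite <- (pd_eq0_l _ _ _ Hz), <- (pd_eq0_l _ _ _ Hx),
    <- (pd_eq0_r _ _ _ Hy), <- (pd_eq0_r _ _ _ Hy).
  pose proof (qg_lower _ _ _ _ _ a b Hl Hq ltac:(lra) ltac:(lra)) as L.
  destruct (Hq u b Hu ltac:(lra)) as [_ U].
  assert (Rabs (u - b) <= Rabs (a - b)) by (rabs; lra). nra.
Qed.

Lemma geodesic_between x y A z : qpath d 1 0 x y A -> A z -> d x z + d z y = d x y.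
Proof.
  intros (q & a & b & Hab & Hq & Hx & Hy & HA) Hz. apply HA in Hz.
  destruct Hz as (u & Hu & Hz). apply qg_geodesic in Hq.
  rewrite <- (pd_eq0_l _ _ _ Hz), <- !(pd_eq0_l _ _ _ Hx),
    <- !(pd_eq0_r _ _ _ Hy), <- (pd_eq0_r _ _ _ Hz).
  rewrite !Hq by lra. rabs; lra.
Qed.

(** The path is prolonged by one parameter unit at each side, on which it is constantly [x'] or
    [y']; this keeps all of [A] in the new image. The new path is [C]-close to [q] composed with the
    clamping [cl], which costs [2 * C], and [cl] shortens parameter intervals by at most 2. *)
Lemma qpath_move (lam eps C : R) x y x' y' A : 1 <= lam -> 0 <= eps ->
  qpath d lam eps x y A -> d x x' <= C -> d y y' <= C ->
  exists A', qpath d lam (eps + 2 * C + 2) x' y' A' /\ (forall z, A z -> A' z) /\ shadow d C A' A.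
Proof.
  intros Hl He (q & a & b & Hab & Hq & Hx & Hy & HA) Hxx Hyy.
  assert (HC : 0 <= C) by (pose proof (pd_ge0 x x'); lra).
  set (q' := fun u => if Rlt_dec u a then x' else if Rlt_dec b u then y' else q u).
  set (cl := fun u => if Rlt_dec u a then a else if Rlt_dec b u then b else u).
  assert (Hcl : forall u, a <= cl u <= b).
  { intro u; unfold cl; destruct (Rlt_dec u a), (Rlt_dec b u); lra. }
  assert (Hclose : forall u, d (q' u) (q (cl u)) <= C).
  { intro u; unfold cl, q'; destruct (Rlt_dec u a); [|destruct (Rlt_dec b u)].
    - rewrite pd_sym, (pd_eq0_l _ _ _ Hx); assumption.
    - rewrite pd_sym, (pd_eq0_l _ _ _ Hy); assumption.
    - rewrite pd_refl; assumption. }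
  exists (image d q' (a - 1) (b + 1)). split; [|split].
  - exists q', (a - 1), (b + 1). split; [lra|split; [|split; [|split; [|auto using iff_refl]]]].
    + assert (K : 2 * C <= (lam * (2 * C)) ) by nra.
      apply qg_of_bounds; [assumption|].
      intros u v Hu Hv.
      pose proof (Hclose u) as Cu. pose proof (Hclose v) as Cv.
      pose proof (qg_lower _ _ _ _ _ (cl u) (cl v) Hl Hq (Hcl u) (Hcl v)) as L.
      destruct (Hq (cl u) (cl v) (Hcl u) (Hcl v)) as [_ U].
      pose proof (pd_tri (q (cl u)) (q' u) (q (cl v))) as T1.
      pose proof (pd_tri (q' u) (q' v) (q (cl v))) as T2.
      pose proof (pd_tri (q' u) (q (cl u)) (q' v)) as T3.
      pose proof (pd_tri (q (cl u)) (q (cl v)) (q' v)) as T4.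
      rewrite (pd_sym (q (cl u)) (q' u)) in T1.
      rewrite (pd_sym (q (cl v)) (q' v)) in T4.
      assert (R1 : v - u <= Rabs (cl u - cl v) + 2).
      { unfold cl; destruct (Rlt_dec u a), (Rlt_dec b u), (Rlt_dec v a), (Rlt_dec b v);
          rabs; lra. }
      assert (R2 : Rabs (cl u - cl v) <= v - u).
      { unfold cl; destruct (Rlt_dec u a), (Rlt_dec b u), (Rlt_dec v a), (Rlt_dec b v);
          rabs; lra. }
      split; nra.
    + unfold q'. destruct (Rlt_dec (a - 1) a); [apply pd_refl|lra].
    + unfold q'. destruct (Rlt_dec (b + 1) a); [lra|].
      destruct (Rlt_dec b (b + 1)); [apply pd_refl|lra].
  - intros z Hz. apply HA in Hz. destruct Hz as (u & Hu & Hz). exists u. split; [lra|].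
    unfold q'. destruct (Rlt_dec u a); [lra|]. destruct (Rlt_dec b u); [lra|assumption].
  - intros z (u & Hu & Hz). exists (q (cl u)). split.
    + apply HA. exists (cl u). auto using pd_refl.
    + rewrite <- (pd_eq0_l _ _ _ Hz). apply Hclose.
Qed.

Lemma stable_move (lam eps C D : R) x y x' y' : 1 <= lam -> 0 <= eps ->
  stable d lam (eps + 2 * C + 2) D x' y' -> d x x' <= C -> d y y' <= C ->
  stable d lam eps (D + C) x y.
Proof.
  intros Hl He HS Hx Hy A B HA HB z Hz.
  destruct (qpath_move _ _ C _ _ x' y' A Hl He HA Hx Hy) as (A' & HA' & SA & _).
  destruct (qpath_move _ _ C _ _ x' y' B Hl He HB Hx Hy) as (B' & HB' & _ & SB).
  destruct (HS A' B' HA' HB' z (SA z Hz)) as (w & Hw & Hzw).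
  destruct (SB w Hw) as (v & Hv & Hwv).
  exists v. split; [assumption|]. pose proof (pd_tri z w v). lra.
Qed.

(** Let z be on [A], w on [T] and r their distance. Since [m] is nearly nearest to [p], the detour
    through z cannot save more than 1, so d(m, w) <= r + 1 and hence d(z, m) <= 2 r + 1. The
    parameter distance is thus at most lam (2 r + 1 + eps) + r + 1, whence the factor 3. *)
Lemma qpath_concat (lam eps : R) x m p A T : 1 <= lam -> 0 <= eps ->
  qpath d lam eps x m A -> qpath d 1 0 m p T ->
  (forall z, A z -> d p m <= d p z + 1) ->
  exists A', qpath d (3 * lam) (eps + 1) x p A' /\ (forall z, A' z <-> A z \/ T z).
Proof.
  intros Hl He (q & a & b & Hab & Hq & Hx & Hm & HA)
    (t & c & e & Hce & Ht & Hc & Hp & HT) Hn.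
  apply qg_geodesic in Ht.
  set (q' := fun u => if Rle_dec u b then q u else t (u - b + c)).
  exists (image d q' a (b + (e - c))). split.
  - exists q', a, (b + (e - c)). split; [lra|split; [|split; [|split; [|auto using iff_refl]]]].
    + apply qg_of_bounds; [nra|].
      intros u v Hu Hv. unfold q'.
      destruct (Rle_dec u b), (Rle_dec v b); try lra.
      * pose proof (qg_lower _ _ _ _ _ u v Hl Hq ltac:(lra) ltac:(lra)) as L.
        destruct (Hq u v ltac:(lra) ltac:(lra)) as [_ U].
        rewrite Rabs_minus_sym, Rabs_pos_eq in L, U by lra.
        pose proof (pd_ge0 (q u) (q v)). split; nra.
      * set (w := v - b + c). assert (Hw : c <= w <= e) by (unfold w; lra).
        pose proof (qg_lower _ _ _ _ _ u b Hl Hq ltac:(lra) ltac:(lra)) as L.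
        destruct (Hq u b ltac:(lra) ltac:(lra)) as [_ U].
        rewrite Rabs_minus_sym, Rabs_pos_eq in L, U by lra.
        assert (Hu' : A (q u)) by (apply HA; exists u; split; [lra|apply pd_refl]).
        specialize (Hn _ Hu').
        pose proof (pd_tri p (t w) (q u)) as T1.
        assert (E1 : d p (t w) = e - w).
        { rewrite <- (pd_eq0_l _ _ _ Hp), Ht by lra. rabs; lra. }
        assert (E2 : d p m = e - c).
        { rewrite <- (pd_eq0_l _ _ _ Hp), <- (pd_eq0_r _ _ _ Hc), Ht by lra. rabs; lra. }
        assert (E3 : d (q b) (t w) = w - c).
        { rewrite (pd_eq0_l _ _ _ Hm), <- (pd_eq0_l _ _ _ Hc), Ht by lra. rabs; lra. }
        pose proof (pd_tri (q u) (t w) (q b)) as T2.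
        pose proof (pd_tri (q u) (q b) (t w)) as T3.
        rewrite (pd_sym (t w)) in T1. rewrite (pd_sym (t w)) in T2.
        assert (E4 : v = b + (w - c)) by (unfold w; lra).
        pose proof (pd_ge0 (q u) (t w)).
        split; [|nra].
        assert (b - u <= lam * (2 * d (q u) (t w) + 1 + eps)).
        { eapply Rle_trans; [exact L|]. apply Rmult_le_compat_l; lra. }
        nra.
      * rewrite Ht by lra. rabs; split; nra.
    + unfold q'. destruct (Rle_dec a b); [assumption|lra].
    + unfold q'. destruct (Rle_dec (b + (e - c)) b).
      * assert (e = c) by lra. subst e. replace (b + (c - c)) with b by lra. rewrite (pd_eq0_l _ _ _ Hm), <- (pd_eq0_l _ _ _ Hc).
        assumption.
      * replace (b + (e - c) - b + c) with e by lra. assumption.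
  - intro z. rewrite HA, HT. unfold image, q'. split.
    + intros (u & Hu & Hz). destruct (Rle_dec u b); [left|right].
      * exists u; split; [lra|assumption].
      * exists (u - b + c); split; [lra|assumption].
    + intros [(u & Hu & Hz)|(u & Hu & Hz)].
      * exists u; split; [lra|]. destruct (Rle_dec u b); [assumption|lra].
      * destruct (Req_dec u c) as [->|Hne].
        -- exists b; split; [lra|]. destruct (Rle_dec b b); [|lra].
           rewrite (pd_eq0_l _ _ _ Hm), <- (pd_eq0_l _ _ _ Hc). assumption.
        -- exists (b + (u - c)); split; [lra|]. destruct (Rle_dec (b + (u - c)) b); [lra|].
           replace (b + (u - c) - b + c) with u by lra. assumption.
Qed.

(** * Morse geodesics and asymptotic Morse rays *)

Lemma segment_qpath (J : R -> Prop) (g : R -> X) (s t : R) :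
  isom_on d J g -> (forall u, s <= u <= t -> J u) -> s <= t ->
  qpath d 1 0 (g s) (g t) (image d g s t).
Proof.
  intros Hg HJ Hst. apply qpath_of_qg; [assumption|]. eapply isom_qg; eauto.
Qed.

Lemma Morse_qpath (N : R -> R -> R) (J : R -> Prop) (g : R -> X) (lam eps s t : R) x y A :
  Morse d N J g -> 1 <= lam -> 0 <= eps -> qpath d lam eps x y A -> J s -> J t ->
  d x (g s) = 0 -> d y (g t) = 0 -> forall z, A z -> exists v, J v /\ d z (g v) <= N lam eps.
Proof.
  intros HM Hl He (q & a & b & Hab & Hq & Hx & Hy & HA) Hs Ht Ex Ey z Hz.
  apply HA in Hz. destruct Hz as (u & Hu & Hz).
  destruct (HM lam eps q a b s t Hl He Hab Hq Hs Ht) with (u := u) as (v & Hv & Hd); auto.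
  - rewrite (pd_eq0_l _ _ _ Hx); assumption.
  - rewrite (pd_eq0_l _ _ _ Hy); assumption.
  - exists v; split; [assumption|]. rewrite <- (pd_eq0_l _ _ _ Hz); assumption.
Qed.

(** Both paths stay [K]-close to [g]. If a point of [A] is near [g r] with r between s and t, then
    [B], going from [g s] to [g t], must pass near [g r] too. If r lies beyond an end, [A] has
    overshot that end and has to come back, and the excursion is short because [A] is a
    quasi-geodesic; the common endpoint then serves as the point of [B]. The bound is fixed before
    [g], so it is uniform over all [N]-Morse geodesics. *)
Lemma Morse_stable (N : R -> R -> R) (lam eps : R) : 1 <= lam -> 0 <= eps ->
  exists D, forall (J : R -> Prop) (g : R -> X) s t, isom_on d J g -> Morse d N J g ->
    J s -> J t -> stable d lam eps D (g s) (g t).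
Proof.
  intros Hl He. set (K := N lam eps). set (C := 2 * K + lam + eps).
  set (E := lam * (lam * (K + C + eps)) + eps).
  exists (2 * K + C + E).
  intros J g s t Hg HM Hs Ht A B HA HB z Hz.
  pose proof (Morse_qpath _ _ _ _ _ s t _ _ A HM Hl He HA Hs Ht (pd_refl _) (pd_refl _))
    as NA.
  pose proof (Morse_qpath _ _ _ _ _ s t _ _ B HM Hl He HB Hs Ht (pd_refl _) (pd_refl _))
    as NB.
  fold K in NA, NB.
  destruct (NA z Hz) as (r & Hr & Hzr).
  assert (HK : 0 <= K) by (pose proof (pd_ge0 z (g r)); lra).
  assert (HE : 0 <= E).
  { assert (0 <= lam * (K + C + eps)) by (apply Rmult_le_pos; unfold C; lra). unfold E; nra. }
  (* A path near [g] cannot skip a parameter [m] of [g]: over a unit of its own parameter, the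
     parameter of a nearby point of [g] jumps by at most [C]. *)
  assert (Pass : forall q a b s0 t0 m, a <= b -> qg d lam eps q a b ->
     (forall u, a <= u <= b -> exists v, J v /\ d (q u) (g v) <= K) ->
     J s0 -> J t0 -> J m -> d (q a) (g s0) <= K -> d (q b) (g t0) <= K ->
     (s0 <= m <= t0 \/ t0 <= m <= s0) ->
     exists u, a <= u <= b /\ d (q u) (g m) <= K + C).
  { intros q a b s0 t0 m Hab Hq Hnear Js Jt Jm Hxs Hyt Hm.
    destruct (relational_ivt (fun u v => J v /\ d (q u) (g v) <= K) C a b s0 t0 m)
      as (u & v & Hu & [Jv Hv] & Hvm); auto.
    - unfold C; lra.
    - intros u u' v v' Hu Hu' [Jv Hv] [Jv' Hv'] Huu. rewrite <- (Hg v v') by assumption.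
      destruct (Hq u u' Hu Hu') as [_ U].
      pose proof (pd_tri (g v) (q u) (g v')). pose proof (pd_tri (q u) (q u') (g v')).
      rewrite (pd_sym (g v) (q u)) in H. assert (lam * Rabs (u - u') <= lam * 1) by (apply Rmult_le_compat_l; lra).
      unfold C. lra.
    - exists u. split; [auto|]. pose proof (pd_tri (q u) (g v) (g m)).
      rewrite (Hg v m) in H by assumption. lra. }
  (* Bounds an excursion: between two nearby points the parameter interval is short, so everything
     visited meanwhile is within [E]. *)
  assert (Back : forall q a b u w y, qg d lam eps q a b -> a <= u <= b -> a <= w <= b ->
     a <= y <= b -> (w <= u <= y \/ y <= u <= w) -> d (q w) (q y) <= K + C ->
     d (q u) (q y) <= E).
  { intros q a b u w y Hq Hu Hw Hy Hbt Hd.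
    pose proof (qg_lower _ _ _ _ _ w y Hl Hq Hw Hy) as L.
    destruct (Hq u y Hu Hy) as [_ U].
    assert (Rabs (u - y) <= Rabs (w - y)) by (rabs; lra).
    unfold E. nra. }
  destruct HA as (q & a & b & Hab & Hq & Hx & Hy & HAz).
  pose proof (qpath_ends _ _ _ _ _ HB) as [Bs Bt].
  apply HAz in Hz. destruct Hz as (u & Hu & Hz).
  assert (NA' : forall w, a <= w <= b -> exists v, J v /\ d (q w) (g v) <= K).
  { intros w Hw. apply NA, HAz. exists w. auto using pd_refl. }
  rewrite <- (pd_eq0_l _ _ _ Hz) in Hzr.
  assert (Hcase : (s <= r <= t \/ t <= r <= s) \/ (s <= t <= r \/ r <= t <= s) \/
                  (r <= s <= t \/ t <= s <= r)) by lra.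
  destruct Hcase as [H|[H|H]].
  - destruct HB as (q2 & a2 & b2 & Hab2 & Hq2 & Hx2 & Hy2 & HB).
    destruct (Pass q2 a2 b2 s t r) as (w & Hw & Hwr); auto; try lra.
    { intros w Hw. apply NB, HB. exists w. auto using pd_refl. }
    exists (q2 w). split; [apply HB; exists w; auto using pd_refl|].
    rewrite <- (pd_eq0_l _ _ _ Hz). pose proof (pd_tri (q u) (g r) (q2 w)).
    rewrite (pd_sym (g r)) in H0. lra.
  - destruct (Pass q a u s r t) as (w & Hw & Hwr); auto; try lra.
    { eapply qg_sub; eauto; lra. }
    { intros; apply NA'; lra. }
    exists (g t). split; [assumption|].
    rewrite <- (pd_eq0_l _ _ _ Hz), <- (pd_eq0_r _ _ _ Hy).
    rewrite <- (pd_eq0_r _ _ _ Hy) in Hwr.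
    pose proof (Back q a b u w b Hq). unfold C in *. lra.
  - destruct (Pass q u b r t s) as (w & Hw & Hwr); auto; try lra.
    { eapply qg_sub; eauto; lra. }
    { intros; apply NA'; lra. }
    exists (g s). split; [assumption|].
    rewrite <- (pd_eq0_l _ _ _ Hz), <- (pd_eq0_r _ _ _ Hx).
    rewrite <- (pd_eq0_r _ _ _ Hx) in Hwr.
    pose proof (Back q a b u w a Hq). unfold C in *. lra.
Qed.

(** The form in which surgery is used: cutting at the point nearest to [p] allows both halves, the
    second one run backwards, to be continued to [p] by the same geodesic [T]. *)
Lemma concat_nearest (lam eps : R) x y p A : geodesic_space d -> 1 <= lam -> 0 <= eps ->
  qpath d lam eps x y A ->
  exists m A1 A2 T, A m /\ qpath d 1 0 m p T /\
    (forall z, A z -> A1 z \/ A2 z) /\ (forall z, A1 z -> A z) /\ (forall z, A2 z -> A z) /\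
    (forall z, A z -> d p m <= d p z + 1) /\ qpath d lam eps m y A2 /\
    (exists B, qpath d (3 * lam) (eps + 1) x p B /\ forall z, B z <-> A1 z \/ T z) /\
    (exists B, qpath d (3 * lam) (eps + 1) y p B /\ forall z, B z <-> A2 z \/ T z).
Proof.
  intros Hgeo Hl He HA.
  destruct (nearest_exists p A) as (m & Hm & Hn).
  { exists x. apply (qpath_ends _ _ _ _ _ HA). }
  destruct (qpath_split _ _ _ _ _ m HA Hm) as (A1 & A2 & HA1 & HA2 & HS & S1 & S2).
  destruct (Hgeo m p) as [T HT].
  exists m, A1, A2, T. do 7 (split; [assumption|]). split.
  - apply (qpath_concat lam eps x m p A1 T); auto.
  - apply (qpath_concat lam eps y m p A2 T); auto. now apply qpath_sym.
Qed.

(** Go from [be 0] straight to [al v0], follow [al], and far away jump back to [be]: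
    this [(9, 2)]-quasi-geodesic has both endpoints on [be] and contains [al v0]. *)
Lemma asymptotic_merge (N : R -> R -> R) (al be : R -> X) (v0 : R) :
  geodesic_space d -> isom_on d ray al -> isom_on d ray be -> Morse d N ray be ->
  asymptotic d al be -> 0 <= v0 ->
  (forall v, 0 <= v -> d (be 0) (al v0) <= d (be 0) (al v) + 1) ->
  exists w, 0 <= w /\ d (al v0) (be w) <= N 9 2.
Proof.
  intros Hgeo Hal Hbe HM [K HK] Hv0 Hnear.
  assert (K0 : 0 <= K).
  { destruct (HK 0) as (t & _ & Ht); [lra|]. pose proof (pd_ge0 (al 0) (be t)). lra. }
  (* So far out that the second surgery leaves [al v0] on the path: were it on the part [A2] cut
     off, which joins points at distance at most [2 * K + 1], then [qpath_diam] would give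
     [T - v0 <= 9 * (2 * K + 2) + 1]. *)
  set (T := v0 + 9 * (2 * K + 2) + 2).
  destruct (HK T) as (t & Ht & HKt); [unfold T; lra|].
  assert (Hseg : qpath d 1 0 (al T) (al v0) (image d al v0 T)).
  { apply qpath_sym, segment_qpath with (J := ray); auto; unfold ray, T; intros; lra. }
  destruct (Hgeo (al v0) (be 0)) as [E HE].
  destruct (qpath_concat 1 0 (al T) (al v0) (be 0) _ E ltac:(lra) ltac:(lra) Hseg HE)
    as (A & HA & EA).
  { intros z (u & Hu & Hz). rewrite <- (pd_eq0_r _ _ _ Hz). apply Hnear; lra. }
  replace (3 * 1) with 3 in HA by lra. replace (0 + 1) with 1 in HA by lra.
  apply qpath_sym in HA.
  destruct (concat_nearest 3 1 _ _ (be t) A Hgeo ltac:(lra) ltac:(lra) HA)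
    as (m & A1 & A2 & F & Hm & HF & HS & S1 & S2 & Hn & HA2 & (B & HB & EB) & _).
  replace (3 * 3) with 9 in HB by lra. replace (1 + 1) with 2 in HB by lra.
  assert (Hp : A (al v0)).
  { apply EA. right. apply (qpath_ends _ _ _ _ _ HE). }
  destruct (HS _ Hp) as [Hp1|Hp2].
  - apply (Morse_qpath N ray be 9 2 0 t (be 0) (be t) B HM); try lra; auto using pd_refl.
    + unfold ray; lra.
    + apply EB; auto.
  - exfalso.
    pose proof (qpath_diam 3 1 _ _ _ _ ltac:(lra) HA2 Hp2) as D.
    rewrite Hal in D by (unfold ray, T; lra).
    specialize (Hn (al T) (proj2 (qpath_ends _ _ _ _ _ HA))).
    pose proof (pd_tri m (be t) (al T)).
    rewrite (pd_sym m (be t)), (pd_sym (be t) (al T)) in H.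
    rewrite (pd_sym (be t) (al T)) in Hn.
    replace (Rabs (v0 - T)) with (T - v0) in D by (unfold T; rabs; lra).
    unfold T in *. lra.
Qed.

(** The merging point is called [p] here, and [m], [m'] are its projections to the two
    quasi-geodesics. Everything reduces to the pairs [x], [p] and [y], [p], each of which lies on or
    near a single Morse ray. The slack [c] admits points that are not vertices. *)
Lemma asymptotic_stable (N : R -> R -> R) (c lam eps : R) :
  geodesic_space d -> 1 <= lam -> 0 <= eps -> 0 <= N 9 2 -> 0 <= c ->
  exists D, forall x y al be, isom_on d ray al -> isom_on d ray be ->
    Morse d N ray al -> Morse d N ray be -> asymptotic d al be ->
    d x (al 0) <= c -> d y (be 0) <= c -> stable d lam eps D x y.
Proof.
  intros Hgeo Hl He HN Hc.
  set (eps0 := eps + 2 * c + 2). set (N0 := N 9 2).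
  destruct (Morse_stable N (3 * lam) (eps0 + 1)) as [D1 HD1]; [lra|unfold eps0; lra|].
  destruct (Morse_stable N (3 * lam) (eps0 + 1 + 2 * N0 + 2)) as [D2 HD2];
    [lra|unfold eps0, N0; lra|].
  set (D2' := D2 + N0). set (D := D1 + D2').
  exists (D1 + D2' + (D2' + D + 1) + c).
  intros x0 y0 al be Hal Hbe Mal Mbe Has Hx Hy.
  apply (stable_move lam eps c _ x0 y0 (al 0) (be 0)); auto.
  fold eps0. assert (He0 : 0 <= eps0) by (unfold eps0; lra). clearbody eps0. clear x0 y0 Hx Hy.
  set (x := al 0). set (y := be 0).
  destruct (nearest_exists y (fun z => exists v, 0 <= v /\ z = al v)) as (p & (v0 & Hv0 & ->) & Hp0).
  { exists (al 0), 0. split; [lra|reflexivity]. }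
  assert (Hp : forall v, 0 <= v -> d y (al v0) <= d y (al v) + 1) by eauto.
  clear Hp0. set (p := al v0) in *.
  destruct (asymptotic_merge N al be v0 Hgeo Hal Hbe Mbe Has Hv0 Hp) as (w & Hw & Hpw).
  fold N0 p in Hpw.
  assert (Sxp : stable d (3 * lam) (eps0 + 1) D1 x p).
  { apply HD1 with ray; auto; unfold ray; lra. }
  (* [p] is not on [be] but within [N0] of it, so the endpoint is moved from [p] to [be w]; hence
     the enlarged additive constant in [D2]. *)
  assert (Syp : stable d (3 * lam) (eps0 + 1) D2' y p).
  { apply stable_move with y (be w); try lra.
    - apply HD2 with ray; auto; unfold ray; lra.
    - rewrite pd_refl. assumption. }
  destruct (Hgeo y p) as [E HE].
  (* Why projections are close to [p]: [m] is within [D1] of a point e1 of [al] and within [D2'] of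
     a point e2 of the geodesic from [y] to [p]. As [p] is nearly the point of [al] nearest to [y],
     going on from e2 to [p] is at most [D + 1] long. *)
  assert (Hclose : forall A m A1 A2 T, qpath d 1 0 m p T ->
    (forall z, A z -> A1 z \/ A2 z) ->
    (exists B, qpath d (3 * lam) (eps0 + 1) x p B /\ forall z, B z <-> A1 z \/ T z) ->
    (exists B, qpath d (3 * lam) (eps0 + 1) y p B /\ forall z, B z <-> A2 z \/ T z) ->
    d m p <= D2' + D + 1).
  { intros A m A1 A2 T HT HS (B1 & HB1 & EB1) (B2 & HB2 & EB2).
    pose proof (qpath_ends _ _ _ _ _ HT) as [Tm _].
    destruct (Sxp B1 (image d al 0 v0) HB1) with (z := m) as (e1 & (r & Hr & He1) & Hd1).
    { apply (qpath_weaken 1 0); try lra. apply segment_qpath with ray; auto; unfold ray; intros; lra. }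
    { apply EB1; auto. }
    destruct (Syp B2 E HB2) with (z := m) as (e2 & He2 & Hd2).
    { apply (qpath_weaken 1 0); try lra. assumption. }
    { apply EB2; auto. }
    pose proof (geodesic_between _ _ _ _ HE He2) as Hb.
    pose proof (Hp r ltac:(lra)) as Hr1. rewrite (pd_eq0_r _ _ _ He1) in Hr1.
    pose proof (pd_tri y e2 e1). pose proof (pd_tri e2 m e1). pose proof (pd_tri m e2 p).
    rewrite (pd_sym e2 m) in H0. unfold D. lra. }
  intros A B HA HB z Hz.
  destruct (concat_nearest lam eps0 _ _ p A Hgeo Hl He0 HA)
    as (m & A1 & A2 & T & Hm & HT & HS & S1 & S2 & _ & _ & X1 & Y1).
  destruct (concat_nearest lam eps0 _ _ p B Hgeo Hl He0 HB)
    as (m' & B1 & B2 & T' & Hm' & HT' & HS' & S1' & S2' & _ & _ & X2 & Y2).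
  pose proof (Hclose B m' B1 B2 T' HT' HS' X2 Y2) as Hm'p.
  (* Shadowing may end on the added geodesic [T'] instead of on [B]; as [T'] is short, [m'] can be
     taken instead. *)
  assert (HT'm : forall e, T' e -> d e m' <= D2' + D + 1).
  { intros e He'. pose proof (geodesic_between _ _ _ _ HT' He'). pose proof (pd_ge0 e p).
    rewrite (pd_sym e m'). lra. }
  pose proof (pd_ge0 m' p) as Hpos.
  destruct X1 as (AX & HAX & EAX), Y1 as (AY & HAY & EAY),
    X2 as (BX & HBX & EBX), Y2 as (BY & HBY & EBY).
  assert (P1 : 0 <= D1).
  { destruct (Sxp AX BX HAX HBX x) as (e & _ & Hd); [apply (qpath_ends _ _ _ _ _ HAX)|].
    pose proof (pd_ge0 x e). lra. }
  assert (P2 : 0 <= D2').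
  { destruct (Syp AY BY HAY HBY y) as (e & _ & Hd); [apply (qpath_ends _ _ _ _ _ HAY)|].
    pose proof (pd_ge0 y e). lra. }
  destruct (HS z Hz) as [Hz1|Hz2].
  - destruct (Sxp AX BX HAX HBX z) as (e & He' & Hd); [apply EAX; auto|].
    apply EBX in He'. destruct He' as [He'|He'].
    + exists e. split; [auto|]. unfold D. lra.
    + exists m'. split; [assumption|]. pose proof (pd_tri z e m'). specialize (HT'm e He'). lra.
  - destruct (Syp AY BY HAY HBY z) as (e & He' & Hd); [apply EAY; auto|].
    apply EBY in He'. destruct He' as [He'|He'].
    + exists e. split; [auto|]. unfold D. lra.
    + exists m'. split; [assumption|]. pose proof (pd_tri z e m'). specialize (HT'm e He'). lra.
Qed.

(** Follow [be] past [be t] and jump to [al] far out: after its start is moved to [al 0], this is a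
    [(3, 3 + 2 * c)]-quasi-geodesic with ends on [al], so [be t] is near some [al v]. Comparing
    distances to the starting points shows that v is close to t. The constant K has disappeared from
    the bound. *)
Lemma asymptotic_fellow (N : R -> R -> R) (c : R) (al be : R -> X) :
  geodesic_space d -> isom_on d ray al -> isom_on d ray be -> Morse d N ray al ->
  0 <= c -> d (be 0) (al 0) <= c -> asymptotic d be al ->
  forall t, 0 <= t -> d (be t) (al t) <= 2 * N 3 (3 + 2 * c) + 2 * c.
Proof.
  intros Hgeo Hal Hbe HM Hc H0 [K HK] t Ht.
  assert (K0 : 0 <= K).
  { destruct (HK 0) as (w & _ & Hw); [lra|]. pose proof (pd_ge0 (be 0) (al w)). lra. }
  (* The jump happens within [2 * K + 1] of [be T], hence after [be t]. *)
  set (T := t + 2 * K + 2).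
  destruct (HK T) as (w & Hw & HKw); [unfold T; lra|].
  assert (Hseg : qpath d 1 0 (be 0) (be T) (image d be 0 T)).
  { apply segment_qpath with (J := ray); auto; unfold ray, T; intros; lra. }
  destruct (concat_nearest 1 0 _ _ (al w) _ Hgeo ltac:(lra) ltac:(lra) Hseg)
    as (m & A1 & A2 & F & Hm & HF & HS & S1 & S2 & Hn & HA2 & (B & HB & EB) & _).
  replace (3 * 1) with 3 in HB by lra. replace (0 + 1) with 1 in HB by lra.
  destruct (HS (be t)) as [Ht1|Ht2].
  - exists t. split; [unfold T; lra|apply pd_refl].
  - destruct (qpath_move 3 1 c _ _ (al 0) (al w) B ltac:(lra) ltac:(lra) HB H0)
      as (B' & HB' & SB & _).
    { rewrite pd_refl. assumption. }
    replace (1 + 2 * c + 2) with (3 + 2 * c) in HB' by lra.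
    destruct (Morse_qpath N ray al 3 (3 + 2 * c) 0 w (al 0) (al w) B' HM) with (z := be t)
      as (v & Hv & Hd); auto using pd_refl; try lra; try (unfold ray; lra).
    { apply SB, EB; auto. }
    assert (Rabs (v - t) <= N 3 (3 + 2 * c) + c).
    { pose proof (pd_tri (al 0) (be t) (al v)) as T1.
      pose proof (pd_tri (al 0) (be 0) (be t)) as T2.
      pose proof (pd_tri (be 0) (al 0) (be t)) as T3.
      pose proof (pd_tri (al 0) (al v) (be t)) as T4.
      rewrite (pd_sym (al v)) in T4. rewrite (pd_sym (al 0) (be 0)) in T2.
      rewrite (Hal 0 v) in T1, T4 by (unfold ray in *; lra).
      rewrite (Hbe 0 t) in T2, T3 by (unfold ray in *; lra).
      unfold ray in Hv. revert T1 T2 T3 T4. rabs; lra. }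
    pose proof (pd_tri (be t) (al v) (al t)) as T5.
    rewrite (Hal v t) in T5 by (unfold ray in *; lra). lra.
  - exfalso. pose proof (qpath_diam 1 0 _ _ _ _ ltac:(lra) HA2 Ht2) as D.
    rewrite Hbe in D by (unfold ray, T; lra).
    specialize (Hn (be T) (proj2 (qpath_ends _ _ _ _ _ Hseg))).
    pose proof (pd_tri m (al w) (be T)).
    rewrite (pd_sym m (al w)), (pd_sym (al w) (be T)) in H.
    rewrite (pd_sym (al w) (be T)) in Hn.
    replace (Rabs (t - T)) with (T - t) in D by (unfold T; rabs; lra).
    unfold T in *. lra.
Qed.

(** Move the endpoints from [be] to [al] with [qpath_move], apply the gauge there, and return to
    [be] at the further cost [C]. *)
Lemma Morse_close (N : R -> R -> R) (C : R) (J : R -> Prop) (al be : R -> X) :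
  0 <= C -> Morse d N J al -> (forall t, J t -> d (be t) (al t) <= C) ->
  Morse d (fun lam eps => N lam (eps + 2 * C + 2) + C) J be.
Proof.
  intros HC HM Hcl lam eps q a b s t Hl He Hab Hq Hs Ht Es Et u Hu.
  destruct (qpath_move lam eps C (be s) (be t) (al s) (al t) (image d q a b) Hl He)
    as (A' & HA' & SA & _); auto.
  { exists q, a, b. auto 10 using iff_refl. }
  destruct (Morse_qpath N J al lam (eps + 2 * C + 2) s t (al s) (al t) A' HM) with (z := q u)
    as (v & Hv & Hd); auto using pd_refl; try lra.
  { apply SA. exists u. auto using pd_refl. }
  exists v. split; [assumption|]. pose proof (pd_tri (q u) (al v) (be v)).
  specialize (Hcl v Hv). rewrite (pd_sym (be v)) in Hcl. lra.
Qed.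

(** Project [z] to the side [al]: the two halves of [al], each continued to [z], are
    [(3, 1)]-quasi-geodesics with the ends of [ga] and of [be], so [N 3 1] is a thinness
    constant. *)
Lemma Morse_segments_thin (N : R -> R -> R) : geodesic_space d ->
  (forall L g, 0 <= L -> isom_on d (fun s => 0 <= s <= L) g -> Morse d N (fun s => 0 <= s <= L) g) ->
  forall x y z L1 L2 L3 al be ga,
    0 <= L1 -> 0 <= L2 -> 0 <= L3 -> isom_on d (fun s => 0 <= s <= L1) al ->
    isom_on d (fun s => 0 <= s <= L2) be -> isom_on d (fun s => 0 <= s <= L3) ga ->
    d (al 0) x = 0 -> d (al L1) y = 0 -> d (be 0) y = 0 -> d (be L2) z = 0 ->
    d (ga 0) x = 0 -> d (ga L3) z = 0 ->
    forall u, 0 <= u <= L1 -> exists v,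
      (0 <= v <= L2 /\ d (al u) (be v) <= N 3 1) \/ (0 <= v <= L3 /\ d (al u) (ga v) <= N 3 1).
Proof.
  intros Hgeo HM x y z L1 L2 L3 al be ga P1 P2 P3 Hal Hbe Hga Ax Ay By Bz Gx Gz u Hu.
  assert (Hseg : qpath d 1 0 x y (image d al 0 L1)).
  { exists al, 0, L1. split; [lra|]. split; [eapply isom_qg; eauto|]. auto using iff_refl. }
  destruct (concat_nearest 1 0 _ _ z _ Hgeo ltac:(lra) ltac:(lra) Hseg)
    as (m & A1 & A2 & F & Hm & HF & HS & S1 & S2 & Hn & HA2 & (B1 & HB1 & EB1) & (B2 & HB2 & EB2)).
  replace (3 * 1) with 3 in * by lra. replace (0 + 1) with 1 in * by lra.
  rewrite pd_sym in Gx, Gz, By, Bz.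
  destruct (HS (al u)) as [H|H].
  - exists u. split; [lra|apply pd_refl].
  - destruct (Morse_qpath N _ ga 3 1 0 L3 x z B1 (HM L3 ga P3 Hga)) with (z := al u)
      as (v & Hv & Hd); auto; try lra.
    { apply EB1; auto. }
    exists v. auto.
  - destruct (Morse_qpath N _ be 3 1 0 L2 y z B2 (HM L2 be P2 Hbe)) with (z := al u)
      as (v & Hv & Hd); auto; try lra.
    { apply EB2; auto. }
    exists v. auto.
Qed.

Lemma asymptotic_trans (f g h : R -> X) : asymptotic d f g -> asymptotic d g h -> asymptotic d f h.
Proof.
  intros [K1 H1] [K2 H2]. exists (K1 + K2). intros s Hs.
  destruct (H1 s Hs) as (t & Ht & Hd1). destruct (H2 t Ht) as (u & Hu & Hd2).
  exists u. split; [assumption|]. pose proof (pd_tri (f s) (g t) (h u)). lra.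
Qed.

(** If [h t] is near [g s], comparing distances to the starting points bounds the difference of s
    and t, so the rays are close at equal parameters. *)
Lemma asymptotic_sym (g h : R -> X) :
  isom_on d ray g -> isom_on d ray h -> asymptotic d g h -> asymptotic d h g.
Proof.
  intros Hg Hh [K HK]. exists (2 * K + d (g 0) (h 0)). intros s Hs.
  exists s. split; [assumption|]. destruct (HK s Hs) as (t & Ht & Hd).
  assert (Hr : Rabs (s - t) <= K + d (g 0) (h 0)).
  { pose proof (pd_tri (g 0) (h 0) (g s)). pose proof (pd_tri (h 0) (h t) (g s)).
    pose proof (pd_tri (h 0) (g 0) (h t)). pose proof (pd_tri (g 0) (g s) (h t)).
    rewrite (pd_sym (h t) (g s)) in H0. rewrite (pd_sym (h 0) (g 0)) in H1.
    rewrite (Hg 0 s) in H, H2 by (unfold ray; lra).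
    rewrite (Hh 0 t) in H0, H1 by (unfold ray; lra).
    revert H H0 H1 H2. rabs; lra. }
  pose proof (pd_tri (h s) (h t) (g s)). rewrite (Hh s t) in H by assumption.
  rewrite (pd_sym (h t)) in H. lra.
Qed.

Lemma geodesic_concat x m y T1 T2 : qpath d 1 0 x m T1 -> qpath d 1 0 m y T2 ->
  d x y = d x m + d m y -> exists T, qpath d 1 0 x y T.
Proof.
  intros (q & a & b & Hab & Hq & Hx & Hm & _) (t & c & e & Hce & Ht & Hc & Hy & _) Hxy.
  apply qg_geodesic in Hq. apply qg_geodesic in Ht.
  set (q' := fun u => if Rle_dec u b then q u else t (u - b + c)).
  exists (image d q' a (b + (e - c))), q', a, (b + (e - c)).
  assert (Hxm : d x m = b - a).
  { rewrite <- (pd_eq0_l _ _ _ Hx), <- (pd_eq0_r _ _ _ Hm), Hq by lra. rabs; lra. }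
  assert (Hmy : d m y = e - c).
  { rewrite <- (pd_eq0_l _ _ _ Hc), <- (pd_eq0_r _ _ _ Hy), Ht by lra. rabs; lra. }
  split; [lra|]. split; [|split; [|split; [|auto using iff_refl]]].
  - apply qg_of_bounds; [lra|]. intros u v Hu Hv. unfold q'.
    destruct (Rle_dec u b), (Rle_dec v b); try lra.
    + rewrite Hq by lra. rabs; lra.
    + set (w := v - b + c). assert (Hw : c <= w <= e) by (unfold w; lra).
      assert (Ew : v = w + b - c) by (unfold w; lra). clearbody w. subst v.
      pose proof (pd_tri x (q u) y) as T3. pose proof (pd_tri (q u) (t w) y) as T4.
      pose proof (pd_tri (q u) m (t w)) as T5.
      assert (E1 : d x (q u) = u - a).
      { rewrite <- (pd_eq0_l _ _ _ Hx), Hq by lra. rabs; lra. }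
      assert (E2 : d (t w) y = e - w).
      { rewrite <- (pd_eq0_r _ _ _ Hy), Ht by lra. rabs; lra. }
      assert (E3 : d (q u) m = b - u).
      { rewrite <- (pd_eq0_r _ _ _ Hm), Hq by lra. rabs; lra. }
      assert (E4 : d m (t w) = w - c).
      { rewrite <- (pd_eq0_l _ _ _ Hc), Ht by lra. rabs; lra. }
      lra.
    + rewrite Ht by lra. rabs; lra.
  - unfold q'. destruct (Rle_dec a b); [assumption|lra].
  - unfold q'. destruct (Rle_dec (b + (e - c)) b).
    + assert (e = c) by lra. subst e. replace (b + (c - c)) with b by lra.
      rewrite (pd_eq0_l _ _ _ Hm), <- (pd_eq0_l _ _ _ Hc). assumption.
    + replace (b + (e - c) - b + c) with e by lra. assumption.
Qed.

Lemma geodesic_parametrize x y T : qpath d 1 0 x y T ->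
  exists g, isom_on d (fun s => 0 <= s <= d x y) g /\ d (g 0) x = 0 /\ d (g (d x y)) y = 0 /\
    (forall z, T z <-> image d g 0 (d x y) z).
Proof.
  intros (q & a & b & Hab & Hq & Hx & Hy & HT). apply qg_geodesic in Hq.
  assert (E : d x y = b - a).
  { rewrite <- (pd_eq0_l _ _ _ Hx), <- (pd_eq0_r _ _ _ Hy), Hq by lra. rabs; lra. }
  exists (fun s => q (s + a)). rewrite E.
  replace (0 + a) with a by lra. replace (b - a + a) with b by lra.
  split; [|split; [assumption|split; [assumption|]]].
  - intros s t Hs Ht. rewrite Hq by lra. f_equal; lra.
  - intro w. rewrite HT. split; intros (u & Hu & Hw).
    + exists (u - a). split; [lra|]. replace (u - a + a) with u by lra. assumption.
    + exists (u + a). split; [lra|assumption].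
Qed.

Lemma Morse_of_segments (N : R -> R -> R) (J : R -> Prop) (g : R -> X) :
  (forall L h, 0 <= L -> isom_on d (fun s => 0 <= s <= L) h ->
     Morse d N (fun s => 0 <= s <= L) h) ->
  (forall s t u, J s -> J t -> s <= u <= t -> J u) -> isom_on d J g -> Morse d N J g.
Proof.
  intros HM HJ Hg.
  assert (Hle : forall lam eps s t A z, 1 <= lam -> 0 <= eps -> J s -> J t -> s <= t ->
    qpath d lam eps (g s) (g t) A -> A z -> exists v, J v /\ d z (g v) <= N lam eps).
  { intros lam eps s t A z Hl He Hs Ht Hst HA Hz.
    set (h := fun u => g (u + s)).
    assert (Hh : isom_on d (fun u => 0 <= u <= t - s) h).
    { intros u v Hu Hv. unfold h. rewrite Hg; [f_equal; lra| |]; apply (HJ s t); auto; lra. }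
    destruct (Morse_qpath N _ h lam eps 0 (t - s) (g s) (g t) A (HM (t - s) h ltac:(lra) Hh))
      with (z := z) as (v & Hv & Hd); auto; try lra.
    - unfold h. replace (0 + s) with s by lra. apply pd_refl.
    - unfold h. replace (t - s + s) with t by lra. apply pd_refl.
    - exists (v + s). split; [apply (HJ s t); auto; lra|exact Hd]. }
  intros lam eps q a b s t Hl He Hab Hq Hs Ht Es Et u Hu.
  assert (HA : qpath d lam eps (g s) (g t) (image d q a b)).
  { exists q, a, b. auto 10 using iff_refl. }
  assert (Hz : image d q a b (q u)) by (exists u; auto using pd_refl).
  destruct (Rle_dec s t).
  - apply (Hle lam eps s t _ (q u)) in HA; auto.
  - apply qpath_sym in HA. apply (Hle lam eps t s _ (q u)) in HA; auto. lra.
Qed.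

(** The piece of [g] between the two endpoints is itself a quasi-geodesic with these endpoints, so
    stability applies to it. *)
Lemma qg_stable_Morse : qg_stable d -> exists N, morse_gauge N /\
  forall L g, 0 <= L -> isom_on d (fun s => 0 <= s <= L) g -> Morse d N (fun s => 0 <= s <= L) g.
Proof.
  intro HS.
  (* The gauge is chosen over all pairs at once; the value 0 fills in outside the range of
     admissible constants, and [Rmax 0 D] secures a sign that stability does not provide. *)
  destruct (functional_choice (fun (p : R * R) K => 0 <= K /\ forall L g s t A z,
    1 <= fst p -> 0 <= snd p -> 0 <= s <= L -> 0 <= t <= L ->
    isom_on d (fun s => 0 <= s <= L) g -> qpath d (fst p) (snd p) (g s) (g t) A -> A z ->
    exists v, 0 <= v <= L /\ d z (g v) <= K)) as [N HN].
  { intros [lam eps]. simpl.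
    destruct (classic (1 <= lam /\ 0 <= eps)) as [[Hl He]|Hno].
    2: { exists 0. split; [lra|]. intros; exfalso; auto. }
    destruct (HS lam eps Hl He) as [D HD]. exists (Rmax 0 D).
    split; [apply Rmax_l|]. intros L g s t A z _ _ Hs Ht Hg HA Hz.
    assert (HB : exists B, qpath d 1 0 (g s) (g t) B /\
      forall e, B e -> exists v, 0 <= v <= L /\ d (g v) e = 0).
    { destruct (Rle_dec s t).
      - exists (image d g s t). split.
        + apply segment_qpath with (fun s => 0 <= s <= L); auto; intros; lra.
        + intros e (v & Hv & E). exists v. split; [lra|assumption].
      - exists (image d g t s). split.
        + apply qpath_sym, segment_qpath with (fun s => 0 <= s <= L); auto; intros; lra.
        + intros e (v & Hv & E). exists v. split; [lra|assumption]. }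
    destruct HB as (B & HB & HBg). apply (qpath_weaken 1 0 lam eps) in HB; try lra.
    destruct (HD _ _ A B HA HB z Hz) as (e & He' & Hd). destruct (HBg e He') as (v & Hv & E).
    exists v. split; [assumption|]. rewrite (pd_eq0_r _ _ _ E).
    pose proof (Rmax_r 0 D). lra. }
  exists (fun lam eps => N (lam, eps)). split.
  - intros lam eps _ _. apply HN.
  - intros L g HL Hg lam eps q a b s t Hl He Hab Hq Hs Ht Es Et u Hu.
    apply (proj2 (HN (lam, eps))) with (s := s) (t := t) (A := image d q a b); auto.
    + exists q, a, b. auto 10 using iff_refl.
    + exists u. auto using pd_refl.
Qed.

(** * Stability of quasi-geodesics in hyperbolic spaces *)

Lemma INR_succ_le_pow2 (n : nat) : INR n + 1 <= 2 ^ n.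
Proof.
  induction n as [|n IH]; [simpl; lra|]. rewrite S_INR. simpl. pose proof (pos_INR n). lra.
Qed.

(** Needed because [D0] below is affine in [k] and its multiple must stay below [2 ^ k]. Even
    exponents do: [2 ^ (2 * m)] is at least the square of [m]. *)
Lemma exponential_dominates_affine (A B : R) : exists k : nat, A * INR k + B <= 2 ^ k.
Proof.
  set (M := Rabs A * 2 + Rabs B + 1).
  destruct (INR_unbounded M) as [m Hm].
  exists (2 * m)%nat. rewrite mult_INR, pow_mult. simpl (INR 2). simpl (2 ^ 2).
  assert (H2 : (2 * (2 * 1)) ^ m = 2 ^ m * 2 ^ m).
  { rewrite <- Rpow_mult_distr. f_equal. lra. }
  rewrite H2. pose proof (INR_succ_le_pow2 m) as H. pose proof (pos_INR m).
  pose proof (Rle_abs A). pose proof (Rle_abs B). pose proof (Rabs_pos A). pose proof (Rabs_pos B).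
  assert (INR m * INR m <= 2 ^ m * 2 ^ m) by nra.
  assert (A * (2 * INR m) <= (Rabs A * 2) * INR m) by nra.
  assert (Rabs B <= Rabs B * INR m) by (unfold M in Hm; nra).
  assert (M * INR m <= INR m * INR m) by nra. unfold M in *. lra.
Qed.

(** Bisect the parameter interval: each thin triangle costs [delta], and after [k] bisections the
    interval has length at most 1, where the path moves by at most [lam + eps]. The bound is
    logarithmic in the length and needs no continuity. *)
Lemma geodesic_near_qg (delta lam eps : R) (k : nat) :
  geodesic_space d -> thin_triangles d delta -> 1 <= lam -> 0 <= eps ->
  forall q a b T z, a <= b -> b - a <= 2 ^ k -> qg d lam eps q a b ->
    qpath d 1 0 (q a) (q b) T -> T z ->
    exists u, a <= u <= b /\ d z (q u) <= INR k * delta + lam + eps.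
Proof.
  intros Hgeo Hthin Hl He. induction k as [|k IH]; intros q a b T z Hab Hk Hq HT Hz.
  - exists a. split; [lra|]. simpl in *. pose proof (geodesic_between _ _ _ _ HT Hz).
    pose proof (pd_ge0 z (q b)). destruct (Hq a b ltac:(lra) ltac:(lra)) as [_ U].
    rewrite Rabs_minus_sym, Rabs_pos_eq in U by lra.
    assert (lam * (b - a) <= lam * 1) by (apply Rmult_le_compat_l; lra).
    rewrite (pd_sym z). lra.
  - set (c := (a + b) / 2). simpl in Hk.
    destruct (Hgeo (q a) (q c)) as [T1 HT1]. destruct (Hgeo (q c) (q b)) as [T2 HT2].
    destruct (Hthin _ _ _ _ _ _ HT (qpath_sym _ _ _ _ _ HT2) HT1 z Hz) as (w & [Hw|Hw] & Hd).
    + destruct (IH q c b T2 w) as (u & Hu & Hdu); auto; try (unfold c; lra).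
      { eapply qg_sub; eauto; unfold c; lra. }
      exists u. split; [unfold c in Hu; lra|]. rewrite S_INR.
      pose proof (pd_tri z w (q u)). lra.
    + destruct (IH q a c T1 w) as (u & Hu & Hdu); auto; try (unfold c; lra).
      { eapply qg_sub; eauto; unfold c; lra. }
      exists u. split; [unfold c in Hu; lra|]. rewrite S_INR.
      pose proof (pd_tri z w (q u)). lra.
Qed.

(** From [g s] go [4 D] to both sides along [g] and jump to [q] there: these jumps
    stay far from [g s], so [g s] is close to the geodesic between the landing
    points, to which the logarithmic bound of [geodesic_near_qg] applies. *)
Lemma geodesic_near_qg_step (delta lam eps D : R) (k : nat) q a b g l :
  geodesic_space d -> thin_triangles d delta -> 1 <= lam -> 0 <= eps -> 0 <= delta -> 0 <= D ->
  a <= b -> qg d lam eps q a b -> 0 <= l -> isom_on d (fun s => 0 <= s <= l) g ->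
  d (g 0) (q a) = 0 -> d (g l) (q b) = 0 ->
  delta < D -> lam * (12 * D + eps) <= 2 ^ k -> (INR k + 2) * delta + lam + eps <= D ->
  (forall s, 0 <= s <= l -> exists u, a <= u <= b /\ d (g s) (q u) <= 2 * D) ->
  forall s, 0 <= s <= l -> exists u, a <= u <= b /\ d (g s) (q u) <= D.
Proof.
  intros Hgeo Hthin Hl He Hdel HD0 Hab Hq Hl0 Hg Ha Hb HD Hk HkD HP s Hs.
  (* Where less than [4 * D] is left, the end of [g] serves; it is at distance 0 from the end of
     [q]. *)
  assert (Hlo : exists s1 u1, 0 <= s1 <= s /\ a <= u1 <= b /\ d (g s1) (q u1) <= 2 * D /\
    s - s1 <= 4 * D /\ (s - s1 = 4 * D \/ d (g s1) (q u1) = 0)).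
  { destruct (Rle_dec (4 * D) s).
    - destruct (HP (s - 4 * D)) as (u & Hu & Hd); [lra|].
      exists (s - 4 * D), u. split; [lra|]. split; [assumption|]. split; [assumption|].
      split; [lra|left; lra].
    - exists 0, a. split; [lra|]. split; [lra|]. split; [lra|]. split; [lra|auto]. }
  assert (Hhi : exists s2 u2, s <= s2 <= l /\ a <= u2 <= b /\ d (g s2) (q u2) <= 2 * D /\
    s2 - s <= 4 * D /\ (s2 - s = 4 * D \/ d (g s2) (q u2) = 0)).
  { destruct (Rle_dec (s + 4 * D) l).
    - destruct (HP (s + 4 * D)) as (u & Hu & Hd); [lra|].
      exists (s + 4 * D), u. split; [lra|]. split; [assumption|]. split; [assumption|].
      split; [lra|left; lra].
    - exists l, b. split; [lra|]. split; [lra|]. split; [lra|]. split; [lra|auto]. }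
  destruct Hlo as (s1 & u1 & Hs1 & Hu1 & Hd1 & Hl1 & Hc1).
  destruct Hhi as (s2 & u2 & Hs2 & Hu2 & Hd2 & Hl2 & Hc2).
  destruct (Hgeo (g s1) (q u1)) as [E1 HE1]. destruct (Hgeo (q u1) (q u2)) as [E2 HE2].
  destruct (Hgeo (g s2) (q u2)) as [E3 HE3]. destruct (Hgeo (g s1) (q u2)) as [F HF].
  assert (HS : qpath d 1 0 (g s1) (g s2) (image d g s1 s2)).
  { apply segment_qpath with (fun s => 0 <= s <= l); auto; intros; lra. }
  assert (Hk0 : 0 <= INR k * delta) by (apply Rmult_le_pos; auto using pos_INR).
  assert (Hend : forall s' u' E w, 0 <= s' <= l -> a <= u' <= b -> d (g s') (q u') <= 2 * D ->
    (Rabs (s - s') = 4 * D \/ d (g s') (q u') = 0) -> qpath d 1 0 (g s') (q u') E ->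
    E w -> d (g s) w <= 2 * delta -> exists u, a <= u <= b /\ d (g s) (q u) <= D).
  { intros s' u' E w Hs' Hu' Hd' Hc HE Hw Hdw.
    pose proof (geodesic_between _ _ _ _ HE Hw) as Hbt.
    pose proof (pd_ge0 w (q u')). pose proof (pd_ge0 (g s') w).
    destruct Hc as [Hc|Hc].
    - exfalso. pose proof (pd_tri (g s) w (g s')) as T.
      rewrite (Hg s s') in T by lra. rewrite (pd_sym w (g s')) in T. lra.
    - exists u'. split; [assumption|]. pose proof (pd_tri (g s) w (q u')). nra. }
  assert (Hmid : forall w, E2 w -> d (g s) w <= 2 * delta ->
    exists u, a <= u <= b /\ d (g s) (q u) <= D).
  { intros w Hw Hdw.
    (* The landing points are at distance at most [2 * D + 8 * D + 2 * D], whence the 12. *)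
    assert (Hlen : Rabs (u1 - u2) <= 2 ^ k).
    { eapply Rle_trans; [|exact Hk]. eapply Rle_trans; [eapply qg_lower; eauto|].
      apply Rmult_le_compat_l; [lra|].
      pose proof (pd_tri (q u1) (g s1) (q u2)). pose proof (pd_tri (g s1) (g s2) (q u2)).
      rewrite (Hg s1 s2), Rabs_minus_sym, Rabs_pos_eq in H0 by lra.
      rewrite (pd_sym (q u1) (g s1)) in H. lra. }
    assert (exists u, a <= u <= b /\ d w (q u) <= INR k * delta + lam + eps) as (u & Hu & Hdu).
    { destruct (Rle_dec u1 u2).
      - rewrite Rabs_minus_sym, Rabs_pos_eq in Hlen by lra.
        destruct (geodesic_near_qg delta lam eps k Hgeo Hthin Hl He q u1 u2 E2 w)
          as (u & Hu & Hdu); auto.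
        { eapply qg_sub; eauto; lra. }
        exists u; split; [lra|assumption].
      - rewrite Rabs_pos_eq in Hlen by lra.
        destruct (geodesic_near_qg delta lam eps k Hgeo Hthin Hl He q u2 u1 E2 w)
          as (u & Hu & Hdu); auto; try lra.
        { eapply qg_sub; eauto; lra. }
        { now apply qpath_sym. }
        exists u; split; [lra|assumption]. }
    exists u. split; [assumption|]. pose proof (pd_tri (g s) w (q u)). lra. }
  destruct (Hthin _ _ _ _ _ _ HS HE3 HF (g s)) as (p & [Hp|Hp] & Hdp).
  { exists s. split; [lra|apply pd_refl]. }
  - apply (Hend s2 u2 E3 p); auto; try lra. rewrite Rabs_minus_sym, Rabs_pos_eq by lra. auto.
  - destruct (Hthin _ _ _ _ _ _ HF (qpath_sym _ _ _ _ _ HE2) HE1 p Hp) as (p' & Hp' & Hdp').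
    pose proof (pd_tri (g s) p p').
    destruct Hp' as [Hp'|Hp'].
    + apply (Hmid p'); [assumption|lra].
    + apply (Hend s1 u1 E1 p'); auto; try lra. rewrite Rabs_pos_eq by lra. auto.
Qed.

(** The preceding lemma halves a bound on the distance from a geodesic to a quasi-geodesic as long
    as it exceeds [D0]. Starting from a trivial bound depending on the length, finitely many
    halvings reach [D0], which does not depend on the endpoints. Two quasi-geodesics are then
    compared through a common geodesic [T]. *)
Lemma hyperbolic_qg_stable (delta : R) :
  geodesic_space d -> 0 <= delta -> thin_triangles d delta -> qg_stable d.
Proof.
  intros Hgeo Hdel Hthin lam eps Hl He.
  destruct (exponential_dominates_affine (lam * (12 * delta))
    (lam * (12 * (2 * delta + lam + eps) + eps))) as [k0 Hk0].
  set (D0 := (INR k0 + 2) * delta + lam + eps).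
  assert (HD0 : delta < D0 /\ 1 <= D0).
  { assert (0 <= INR k0 * delta) by (apply Rmult_le_pos; auto using pos_INR).
    unfold D0; lra. }
  assert (Hk0' : lam * (12 * D0 + eps) <= 2 ^ k0) by (unfold D0; nra).
  set (C := lam * (1 + 2 * D0 + eps)).
  exists (D0 + (lam * C + eps + D0)).
  intros x y A B HA HB z Hz.
  destruct (Hgeo x y) as [T HT].
  assert (Hnear : forall P q a b, a <= b -> qg d lam eps q a b -> d (q a) x = 0 ->
    d (q b) y = 0 -> (forall z, P z <-> image d q a b z) ->
    exists g l, 0 <= l /\ isom_on d (fun s => 0 <= s <= l) g /\ d (g 0) x = 0 /\ d (g l) y = 0 /\
    (forall z, T z <-> image d g 0 l z) /\
    forall s, 0 <= s <= l -> exists u, a <= u <= b /\ d (g s) (q u) <= D0).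
  { intros P q a b Hab Hq Hx Hy HP.
    destruct HT as (g' & c & e & Hce & Hg & Gx & Gy & HT).
    exists (fun s => g' (s + c)), (e - c).
    assert (Hg' : isom_on d (fun s => 0 <= s <= e - c) (fun s => g' (s + c))).
    { apply qg_geodesic in Hg. intros s t Hs Ht. rewrite Hg by lra. f_equal; lra. }
    split; [lra|]. split; [assumption|].
    replace (0 + c) with c by lra. replace (e - c + c) with e by lra.
    split; [assumption|]. split; [assumption|]. split.
    { intro w. rewrite HT. split; intros (u & Hu & E).
      - exists (u - c). split; [lra|]. replace (u - c + c) with u by lra. assumption.
      - exists (u + c). split; [lra|assumption]. }
    assert (Ha : d (g' (0 + c)) (q a) = 0).
    { replace (0 + c) with c by lra. rewrite (pd_eq0_l _ _ _ Gx), pd_sym. assumption. }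
    assert (Hb : d (g' (e - c + c)) (q b) = 0).
    { replace (e - c + c) with e by lra. rewrite (pd_eq0_l _ _ _ Gy), pd_sym. assumption. }
    assert (Hiter : forall j, (forall s, 0 <= s <= e - c ->
        exists u, a <= u <= b /\ d (g' (s + c)) (q u) <= 2 ^ j * D0) ->
      forall s, 0 <= s <= e - c -> exists u, a <= u <= b /\ d (g' (s + c)) (q u) <= D0).
    { induction j as [|j IH]; intro HPj.
      - simpl in HPj. setoid_rewrite Rmult_1_l in HPj. assumption.
      (* At level j the exponent [j + k0] works: the right side [2 ^ (j + k0)] scales with [2 ^ j],
         while the bisection cost grows only linearly in j and stays below [(j + 1) * D0]. *)
      - apply IH. pose proof (INR_succ_le_pow2 j) as H2.
        pose proof (pos_INR j). pose proof (pos_INR k0).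
        apply (geodesic_near_qg_step delta lam eps (2 ^ j * D0) (j + k0) q a b
          (fun s => g' (s + c)) (e - c)); auto; try lra.
        + nra.
        + nra.
        + rewrite pow_add.
          apply Rle_trans with (2 ^ j * (lam * (12 * D0 + eps))); [|nra].
          replace (lam * (12 * (2 ^ j * D0) + eps)) with
            (2 ^ j * (lam * (12 * D0)) + lam * eps) by ring.
          assert (0 <= lam * eps) by nra. nra.
        + rewrite plus_INR.
          apply Rle_trans with ((INR j + 1) * D0); [|nra].
          unfold D0. assert (0 <= INR j * (INR k0 * delta)).
          { apply Rmult_le_pos; [auto|]. apply Rmult_le_pos; auto. }
          assert (0 <= INR j * delta) by nra. assert (0 <= INR j * lam) by nra.
          assert (0 <= INR j * eps) by nra. nra.
        + intros s Hs. destruct (HPj s Hs) as (u & Hu & Hd). exists u. split; [assumption|].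
          simpl in Hd. lra. }
    destruct (exponential_dominates_affine 0 (e - c)) as [j Hj].
    apply (Hiter j). intros s Hs. exists a. split; [lra|].
    rewrite <- (pd_eq0_r _ _ _ Ha).
    rewrite (Hg' s 0) by lra. rewrite Rabs_pos_eq by lra.
    assert (1 <= 2 ^ j) by (apply pow_R1_Rle; lra). nra. }
  assert (HC : 0 <= C) by (unfold C; nra).
  destruct HA as (q & a & b & Hab & Hq & Hx & Hy & HA).
  destruct HB as (q2 & a2 & b2 & Hab2 & Hq2 & Hx2 & Hy2 & HB).
  destruct (Hnear A q a b Hab Hq Hx Hy HA) as (g & l & Hl0 & Hg & Gx & Gy & HTg & Hgq).
  apply HA in Hz. destruct Hz as (u & Hu & Hz).
  assert (exists e, T e /\ d z e <= lam * C + eps + D0) as (e & He' & Hze).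
  (* The reverse inclusion: as s runs along the geodesic, the parameters w with [q w] near [g s] go
     from a to b in jumps of at most [C], so one of them is within [C] of u. *)
  { destruct (relational_ivt (fun s w => a <= w <= b /\ d (g s) (q w) <= D0) C 0 l a b u)
      as (s & w & Hs & [Hw Hsw] & Hwu); auto; try lra.
    - intros s s' w w' Hs Hs' [Hw Hd] [Hw' Hd'] Hss.
      pose proof (qg_lower _ _ _ _ _ w w' Hl Hq Hw Hw') as L.
      eapply Rle_trans; [exact L|]. apply Rmult_le_compat_l; [lra|].
      pose proof (pd_tri (q w) (g s) (q w')). pose proof (pd_tri (g s) (g s') (q w')).
      rewrite (pd_sym (q w) (g s)) in H. rewrite (Hg s s') in H0 by lra. lra.
    - rewrite (pd_eq0_l _ _ _ Gx), pd_sym. lra.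
    - rewrite (pd_eq0_l _ _ _ Gy), pd_sym. lra.
    - exists (g s). split; [apply HTg; exists s; auto using pd_refl|].
      rewrite <- (pd_eq0_l _ _ _ Hz).
      destruct (Hq u w Hu Hw) as [_ U]. rewrite Rabs_minus_sym in U.
      pose proof (pd_tri (q u) (q w) (g s)). rewrite (pd_sym (q w) (g s)) in H.
      assert (lam * Rabs (w - u) <= lam * C) by (apply Rmult_le_compat_l; lra). lra. }
  destruct (Hnear B q2 a2 b2 Hab2 Hq2 Hx2 Hy2 HB) as (g2 & l2 & Hl2 & Hg2 & _ & _ & HTg2 & Hgq2).
  apply HTg2 in He'. destruct He' as (s & Hs & He').
  destruct (Hgq2 s Hs) as (w & Hw & Hd). rewrite (pd_eq0_l _ _ _ He') in Hd.
  exists (q2 w). split; [apply HB; exists w; auto using pd_refl|].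
  pose proof (pd_tri z e (q2 w)). lra.
Qed.

End Pseudometric.

(** Quasi-geodesics are pushed forward along [phi], compared in [Y], and the comparison is pulled
    back by the lower bound. In [K * (D + 3 * C)], two of the [C] come from passing between a path
    and its pushed image, the third from the lower bound. *)
Lemma qg_stable_quasi_isometry {X Y : Type} (dX : X -> X -> R) (dY : Y -> Y -> R)
    (phi : X -> Y) (K C : R) :
  pseudometric dX -> pseudometric dY -> 1 <= K -> 0 <= C ->
  (forall p q, dX p q <= K * (dY (phi p) (phi q) + C)) ->
  (forall p q, dY (phi p) (phi q) <= K * dX p q + C) ->
  qg_stable dY -> qg_stable dX.
Proof.
  intros PX PY HK HC Hlow Hup HS lam eps Hl He.
  set (lam' := K * lam). set (eps' := K * eps + C).
  assert (Hl' : 1 <= lam') by (unfold lam'; nra).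
  assert (He' : 0 <= eps') by (unfold eps'; nra).
  destruct (HS lam' (eps' + 2 * C + 2)) as [D HD]; [assumption|lra|].
  exists (K * (D + 3 * C)).
  intros x y A B HA HB z Hz.
  (* [phi] may separate points at distance 0 by up to [C], so the endpoints have to be moved to
     [phi x] and [phi y]. *)
  assert (push : forall P, qpath dX lam eps x y P -> exists P',
    qpath dY lam' (eps' + 2 * C + 2) (phi x) (phi y) P' /\
    (forall w, P w -> exists w', P' w' /\ dY (phi w) w' <= C) /\
    (forall w', P' w' -> exists w, P w /\ dY w' (phi w) <= C)).
  { intros P (q & a & b & Hab & Hq & Hx & Hy & HP).
    assert (Hq' : qg dY lam' eps' (fun u => phi (q u)) a b).
    { apply (qg_of_bounds PY); [assumption|]. intros s t Hs Ht.
      pose proof (qg_lower lam eps q a b s t Hl Hq ltac:(lra) ltac:(lra)) as L.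
      destruct (Hq s t ltac:(lra) ltac:(lra)) as [_ U].
      rewrite Rabs_minus_sym, Rabs_pos_eq in L, U by lra.
      specialize (Hlow (q s) (q t)). specialize (Hup (q s) (q t)). unfold lam', eps'. split.
      - eapply Rle_trans; [exact L|]. rewrite (Rmult_comm K lam), Rmult_assoc.
        apply Rmult_le_compat_l; [lra|]. assert (eps <= K * eps) by nra.
        assert (K * eps <= K * (K * eps)) by (apply Rmult_le_compat_l; lra). lra.
      - eapply Rle_trans; [exact Hup|].
        assert (K * dX (q s) (q t) <= K * (lam * (t - s) + eps)) by (apply Rmult_le_compat_l; lra).
        lra. }
    pose proof (qpath_of_qg PY lam' eps' _ a b Hab Hq') as HQ.
    destruct (qpath_move PY lam' eps' C _ _ (phi x) (phi y) _ Hl' He' HQ)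
      as (P' & HP' & S1 & S2).
    { specialize (Hup (q a) x). rewrite Hx in Hup. lra. }
    { specialize (Hup (q b) y). rewrite Hy in Hup. lra. }
    exists P'. split; [assumption|]. split.
    - intros w Hw. apply HP in Hw. destruct Hw as (u & Hu & Hw). exists (phi (q u)). split.
      + apply S1. exists u. split; [assumption|]. apply (pd_refl PY).
      + rewrite (pd_sym PY). specialize (Hup (q u) w). rewrite Hw in Hup. lra.
    - intros w' Hw'. destruct (S2 w' Hw') as (w & (u & Hu & Hw) & Hd). exists (q u). split.
      + apply HP. exists u. split; [assumption|]. apply (pd_refl PX).
      + rewrite (pd_eq0_r PY _ _ w' Hw). assumption. }
  destruct (push A HA) as (A' & HA' & SA & _). destruct (push B HB) as (B' & HB' & _ & SB).
  destruct (SA z Hz) as (z1 & Hz1 & Hd1). destruct (HD _ _ A' B' HA' HB' z1 Hz1) as (z2 & Hz2 & Hd2).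
  destruct (SB z2 Hz2) as (v & Hv & Hd3). exists v. split; [assumption|].
  eapply Rle_trans; [apply Hlow|]. apply Rmult_le_compat_l; [lra|].
  pose proof (pd_tri PY (phi z) z1 (phi v)). pose proof (pd_tri PY z1 z2 (phi v)). lra.
Qed.
(** * The Cayley graph *)

Lemma real_Glb_min (E : R -> Prop) (r : R) :
  E r -> (forall r', E r' -> r <= r') -> real (Glb_Rbar E) = r.
Proof.
  intros Hr Hmin. rewrite (is_glb_Rbar_unique E (Finite r)); [reflexivity|]. split.
  - intros r' Hr'. simpl. auto.
  - intros b Hb. apply Hb. assumption.
Qed.

Lemma list_min (E : R -> Prop) (l : list R) : (exists r, In r l /\ E r) ->
  exists r, E r /\ forall r', In r' l -> E r' -> r <= r'.
Proof.
  induction l as [|a l IH]; intros (r & Hr & Er); [destruct Hr|].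
  destruct (classic (exists r, In r l /\ E r)) as [Hl|Hl].
  - destruct (IH Hl) as (m & Em & Hm).
    destruct (classic (E a /\ a <= m)) as [[Ea Ham]|Hno].
    + exists a. split; [assumption|]. intros r' [<-|Hr'] Er'; [lra|].
      specialize (Hm r' Hr' Er'). lra.
    + exists m. split; [assumption|]. intros r' [<-|Hr'] Er'; [|auto].
      destruct (Rle_dec m a); [assumption|]. exfalso; apply Hno; split; [assumption|lra].
  - destruct Hr as [<-|Hr]; [|exfalso; eauto].
    exists a. split; [assumption|]. intros r' [<-|Hr'] Er'; [lra|exfalso; eauto].
Qed.

Section GroupLaws.
Context {G : group}.
Implicit Types a b c : G.

Lemma gcancel_l a b c : gmul a b = gmul a c -> b = c.
Proof.
  intro H. rewrite <- (gmul1 G b), <- (gmul1 G c), <- (gmulV G a), <- !gmulA, H. reflexivity.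
Qed.
Lemma gmulr1 a : gmul a gone = a.
Proof.
  apply (gcancel_l (ginv a)). rewrite gmulA, gmulV, gmul1. reflexivity.
Qed.
Lemma gmulVr a : gmul a (ginv a) = gone.
Proof.
  apply (gcancel_l (ginv a)). rewrite gmulA, gmulV, gmul1, gmulr1. reflexivity.
Qed.
Lemma gmulK a b : gmul a (gmul (ginv a) b) = b.
Proof. rewrite gmulA, gmulVr, gmul1. reflexivity. Qed.
Lemma gmulVK a b : gmul (ginv a) (gmul a b) = b.
Proof. rewrite gmulA, gmulV, gmul1. reflexivity. Qed.
Lemma gmul_fixed a b : gmul a b = a -> b = gone.
Proof. intro H. apply (gcancel_l a). rewrite gmulr1. assumption. Qed.
Lemma ginv_unique a b : gmul a b = gone -> b = ginv a.
Proof. intro H. apply (gcancel_l a). rewrite gmulVr. assumption. Qed.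
Lemma ginvK a : ginv (ginv a) = a.
Proof. symmetry. apply ginv_unique. apply gmulV. Qed.
End GroupLaws.

Section Cayley.
Context {G : group} {S : list G}.
Hypothesis gen : generates G S.
Notation letter := (gen_letter G S).
Notation wd := (word_dist G S).
Notation dist := (dX G S).
Notation point := (cpoint G S).

Lemma letter_inv s : letter s -> letter (ginv s).
Proof.
  intros [Hne Hin]. split.
  - intro H. apply Hne. pose proof (gmulVr s) as E. rewrite H, gmulr1 in E. assumption.
  - rewrite ginvK. tauto.
Qed.

Lemma wprod_app (u v : list G) : wprod G (u ++ v) = gmul (wprod G u) (wprod G v).
Proof.
  induction u as [|s u IH]; simpl; [rewrite gmul1; reflexivity|].
  rewrite IH, gmulA. reflexivity.
Qed.

Lemma word_dist_spec (g h : G) : exists w, List.Forall letter w /\ gmul g (wprod G w) = h /\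
  wd g h = INR (length w) /\
  forall w', List.Forall letter w' -> gmul g (wprod G w') = h -> (length w <= length w')%nat.
Proof.
  assert (Hmin : forall n w, List.Forall letter w -> gmul g (wprod G w) = h ->
    (length w <= n)%nat -> exists w, List.Forall letter w /\ gmul g (wprod G w) = h /\
    forall w', List.Forall letter w' -> gmul g (wprod G w') = h -> (length w <= length w')%nat).
  { induction n as [|n IH]; intros w Hw E Hn.
    - exists w. split; [assumption|]. split; [assumption|]. intros; lia.
    - destruct (classic (exists w', List.Forall letter w' /\ gmul g (wprod G w') = h /\
        (length w' < length w)%nat)) as [(w' & Hw' & E' & Hl)|Hno].
      + apply (IH w'); auto. lia.
      + exists w. split; [assumption|]. split; [assumption|]. intros w' Hw' E'.
        destruct (Nat.le_gt_cases (length w) (length w')); [assumption|].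
        exfalso; apply Hno; eauto. }
  destruct (gen (gmul (ginv g) h)) as (w0 & Hw0 & E0).
  destruct (Hmin (length w0) w0 Hw0) as (w & Hw & E & Hm); [|lia|].
  { rewrite E0, gmulK. reflexivity. }
  exists w. split; [assumption|]. split; [assumption|]. split; [|assumption].
  apply real_Glb_min.
  - exists w. auto.
  - intros r (w' & Hw' & E' & ->). apply le_INR. auto.
Qed.

Lemma word_dist_le (g : G) w : List.Forall letter w -> wd g (gmul g (wprod G w)) <= INR (length w).
Proof.
  intro Hw. destruct (word_dist_spec g (gmul g (wprod G w))) as (w' & _ & _ & E & Hm).
  rewrite E. apply le_INR. auto.
Qed.

Lemma word_dist_ge0 g h : 0 <= wd g h.
Proof. destruct (word_dist_spec g h) as (w & _ & _ & E & _). rewrite E. apply pos_INR. Qed.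

Lemma word_dist_refl g : wd g g = 0.
Proof.
  pose proof (word_dist_ge0 g g). pose proof (word_dist_le g nil (Forall_nil _)).
  simpl in H0. rewrite gmulr1 in H0. lra.
Qed.

Lemma word_dist_tri g h k : wd g k <= wd g h + wd h k.
Proof.
  destruct (word_dist_spec g h) as (u & Hu & Eu & -> & _).
  destruct (word_dist_spec h k) as (v & Hv & Ev & -> & _).
  rewrite <- plus_INR, <- length_app.
  replace k with (gmul g (wprod G (u ++ v))).
  - apply word_dist_le, Forall_app. auto.
  - rewrite wprod_app, gmulA, Eu, Ev. reflexivity.
Qed.

Lemma word_dist_letter_le g s : letter s -> wd g (gmul g s) <= 1.
Proof.
  intro Hs. pose proof (word_dist_le g (s :: nil)). simpl in H. rewrite gmulr1 in H. auto.
Qed.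

Lemma word_dist_letter_sym_le g s : letter s -> wd (gmul g s) g <= 1.
Proof.
  intro Hs. pose proof (word_dist_letter_le (gmul g s) (ginv s) (letter_inv s Hs)).
  rewrite <- gmulA, gmulVr, gmulr1 in H. assumption.
Qed.

Lemma word_dist_sym g h : wd g h = wd h g.
Proof.
  assert (Hle : forall w g, List.Forall letter w -> wd (gmul g (wprod G w)) g <= INR (length w)).
  { induction w as [|s w IH]; intros k Hw.
    - simpl. rewrite gmulr1, word_dist_refl. lra.
    - inversion_clear Hw. specialize (IH (gmul k s) H0). simpl wprod. rewrite gmulA.
      cbn [length]. rewrite S_INR.
      pose proof (word_dist_tri (gmul (gmul k s) (wprod G w)) (gmul k s) k).
      pose proof (word_dist_letter_sym_le k s H). lra. }
  apply Rle_antisym.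
  - destruct (word_dist_spec h g) as (w & Hw & <- & -> & _). auto.
  - destruct (word_dist_spec g h) as (w & Hw & <- & -> & _). auto.
Qed.

Lemma word_dist_lt1 g h : wd g h < 1 -> g = h.
Proof.
  destruct (word_dist_spec g h) as ([|s w] & Hw & <- & E & _); rewrite E.
  - intros _. simpl. rewrite gmulr1. reflexivity.
  - cbn [length]. rewrite S_INR. pose proof (pos_INR (length w)). lra.
Qed.

Lemma word_dist_step g h n : wd g h = INR (Datatypes.S n) ->
  exists s, letter s /\ wd (gmul g s) h = INR n.
Proof.
  destruct (word_dist_spec g h) as (w & Hw & Eh & E & _). rewrite E. intro Hn.
  apply INR_eq in Hn. destruct w as [|s w]; [discriminate|]. simpl in Hn. injection Hn as Hn.
  inversion_clear Hw. exists s. split; [assumption|]. simpl in Eh. rewrite gmulA in Eh.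
  apply Rle_antisym.
  - rewrite <- Hn, <- Eh. apply word_dist_le. assumption.
  - pose proof (word_dist_tri g (gmul g s) h). pose proof (word_dist_letter_le g s H).
    rewrite E in H1. cbn [length] in H1. rewrite S_INR, Hn in H1. lra.
Qed.

Lemma word_dist_letter g s : letter s -> wd g (gmul g s) = 1.
Proof.
  intro Hs. apply Rle_antisym; [apply word_dist_letter_le; assumption|].
  destruct (Rle_dec 1 (wd g (gmul g s))) as [H|H]; [assumption|].
  exfalso. apply Rnot_le_lt, word_dist_lt1, eq_sym, gmul_fixed in H. apply Hs. assumption.
Qed.

Lemma word_dist_translate x g h : wd (gmul x g) (gmul x h) = wd g h.
Proof.
  assert (Hle : forall x g h, wd (gmul x g) (gmul x h) <= wd g h).
  { clear x g h. intros x g h. destruct (word_dist_spec g h) as (w & Hw & <- & -> & _).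
    rewrite gmulA. apply word_dist_le. assumption. }
  apply Rle_antisym; [apply Hle|].
  pose proof (Hle (ginv x) (gmul x g) (gmul x h)). rewrite !gmulVK in H. assumption.
Qed.

Definition dist_candidate (p q : point) (r : R) : Prop :=
  (exists a b, In a (cp_ends G S p) /\ In b (cp_ends G S q) /\
                 r = snd a + wd (fst a) (fst b) + snd b)
  \/ (cp_base G S p = cp_base G S q /\ cp_gen G S p = cp_gen G S q /\
      r = Rabs (cp_t G S p - cp_t G S q))
  \/ (cp_base G S p = gmul (cp_base G S q) (cp_gen G S q) /\
      gmul (cp_base G S p) (cp_gen G S p) = cp_base G S q
      /\ r = Rabs (cp_t G S p - (1 - cp_t G S q))).

(** There are at most six candidate values, four from pairs of ends and two from the orientations of
    a common edge, so the infimum is attained. *)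
Lemma dist_spec p q : dist_candidate p q (dist p q) /\
  forall r, dist_candidate p q r -> dist p q <= r.
Proof.
  set (l := Rabs (cp_t G S p - cp_t G S q) :: Rabs (cp_t G S p - (1 - cp_t G S q)) ::
    flat_map (fun a => map (fun b => snd a + wd (fst a) (fst b) + snd b) (cp_ends G S q))
      (cp_ends G S p)).
  assert (Hl : forall r, dist_candidate p q r -> In r l).
  { intros r [(a & b & Ha & Hb & ->)|[(_ & _ & ->)|(_ & _ & ->)]].
    - right; right. apply in_flat_map. exists a. split; [assumption|].
      apply in_map_iff. exists b. auto.
    - left; reflexivity.
    - right; left; reflexivity. }
  destruct (list_min (dist_candidate p q) l) as (r & Hr & Hm).
  { eexists. assert (E : dist_candidate p q (cp_t G S p + wd (cp_base G S p) (cp_base G S q)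
      + cp_t G S q)).
    { left. exists (cp_base G S p, cp_t G S p), (cp_base G S q, cp_t G S q).
      simpl. auto. }
    split; [apply Hl|]; exact E. }
  assert (E : dist p q = r) by (apply real_Glb_min; [exact Hr|auto]).
  rewrite E. auto.
Qed.

Lemma ends_close p a b : In a (cp_ends G S p) -> In b (cp_ends G S p) ->
  0 <= snd a /\ wd (fst a) (fst b) <= snd a + snd b.
Proof.
  pose proof (cp_t_ok G S p) as Ht. pose proof (word_dist_letter (cp_base G S p) _ (cp_gen_ok G S p)).
  pose proof H as H'. rewrite word_dist_sym in H'.
  intros [<-|[<-|[]]] [<-|[<-|[]]]; simpl; rewrite ?word_dist_refl; lra.
Qed.

(** For the triangle inequality, two routes through ends are joined by [ends_close]; a move inside
    an edge changes the distance to each end by at most its length ([Hedge]), so it can be absorbed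
    into a route through ends ([Hmove]); two moves inside one edge reduce to real numbers. *)
Lemma cayley_pseudometric : pseudometric dist.
Proof.
  assert (Hpos : forall p q, 0 <= dist p q).
  { intros p q. destruct (proj1 (dist_spec p q)) as [(a & b & Ha & Hb & ->)|[(_ & _ & ->)|(_ & _ & ->)]];
      auto using Rabs_pos.
    pose proof (ends_close p a a Ha Ha). pose proof (ends_close q b b Hb Hb).
    pose proof (word_dist_ge0 (fst a) (fst b)). lra. }
  assert (Hsym : forall p q, dist p q <= dist q p).
  { intros p q. apply dist_spec.
    destruct (proj1 (dist_spec q p)) as [(a & b & Ha & Hb & ->)|[(E1 & E2 & ->)|(E1 & E2 & ->)]].
    - left. exists b, a. split; [assumption|]. split; [assumption|].
      rewrite (word_dist_sym (fst b)). lra.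
    - right; left. rewrite Rabs_minus_sym. auto.
    - right; right. split; [auto|]. split; [auto|]. f_equal. lra. }
  split; [|split].
  - intro p. apply Rle_antisym; [|apply Hpos]. apply dist_spec. right; left.
    split; [reflexivity|]. split; [reflexivity|]. rewrite Rminus_diag, Rabs_R0. reflexivity.
  - intros p q. apply Rle_antisym; apply Hsym.
  - assert (Hmove : forall p q r, (exists a b, In a (cp_ends G S p) /\ In b (cp_ends G S q) /\
        dist p q = snd a + wd (fst a) (fst b) + snd b) ->
        (forall b, In b (cp_ends G S q) -> exists c, In c (cp_ends G S r) /\ fst c = fst b /\
           snd c <= snd b + dist q r) -> dist p r <= dist p q + dist q r).
    { intros p q r (a & b & Ha & Hb & ->) H. destruct (H b Hb) as (c & Hc & E & Hle).
      apply Rle_trans with (snd a + wd (fst a) (fst c) + snd c); [|rewrite E; lra].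
      apply dist_spec. left. eauto. }
    assert (Hedge : forall q r, ((cp_base G S q = cp_base G S r /\ cp_gen G S q = cp_gen G S r /\
        dist q r = Rabs (cp_t G S q - cp_t G S r)) \/
      (cp_base G S q = gmul (cp_base G S r) (cp_gen G S r) /\
      gmul (cp_base G S q) (cp_gen G S q) = cp_base G S r /\
      dist q r = Rabs (cp_t G S q - (1 - cp_t G S r)))) ->
      forall b, In b (cp_ends G S q) -> exists c, In c (cp_ends G S r) /\ fst c = fst b /\
           snd c <= snd b + dist q r).
    { intros q r [(E1 & E2 & ->)|(E1 & E2 & ->)] b [<-|[<-|[]]]; simpl.
      - exists (cp_base G S r, cp_t G S r). simpl. split; [auto|split; [auto|rabs; lra]].
      - exists (gmul (cp_base G S r) (cp_gen G S r), 1 - cp_t G S r). simpl.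
        rewrite E1, E2. split; [auto|split; [auto|rabs; lra]].
      - exists (gmul (cp_base G S r) (cp_gen G S r), 1 - cp_t G S r). simpl.
        split; [auto|split; [auto|rabs; lra]].
      - exists (cp_base G S r, cp_t G S r). simpl. split; [auto|split; [auto|rabs; lra]]. }
    intros p q r.
    destruct (proj1 (dist_spec p q)) as [Hpq|Hpq].
    + destruct (proj1 (dist_spec q r)) as [Hqr|Hqr].
      * destruct Hpq as (a & b & Ha & Hb & ->), Hqr as (b' & c & Hb' & Hc & ->).
        destruct (ends_close q b b' Hb Hb') as [_ Hbb].
        pose proof (word_dist_tri (fst a) (fst b) (fst c)).
        pose proof (word_dist_tri (fst b) (fst b') (fst c)).
        apply Rle_trans with (snd a + wd (fst a) (fst c) + snd c); [|lra].
        apply dist_spec. left. eauto.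
      * apply Hmove; auto.
    + destruct (proj1 (dist_spec q r)) as [Hqr|Hqr].
      * replace (dist p r) with (dist r p) by (apply Rle_antisym; apply Hsym).
        replace (dist p q) with (dist q p) by (apply Rle_antisym; apply Hsym).
        replace (dist q r) with (dist r q) by (apply Rle_antisym; apply Hsym).
        rewrite Rplus_comm. apply Hmove.
        -- destruct Hqr as (a & b & Ha & Hb & E). exists b, a. split; [auto|split; [auto|]].
           replace (dist r q) with (dist q r) by (apply Rle_antisym; apply Hsym).
           rewrite E, (word_dist_sym (fst b)). lra.
        -- apply Hedge. replace (dist q p) with (dist p q) by (apply Rle_antisym; apply Hsym).
           destruct Hpq as [(E1 & E2 & E3)|(E1 & E2 & E3)]; [left|right].
           ++ rewrite E3, Rabs_minus_sym. auto.
           ++ split; [auto|split; [auto|]]. rewrite E3. f_equal. lra.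
      * destruct Hpq as [(E1 & E2 & Ep)|(E1 & E2 & Ep)], Hqr as [(F1 & F2 & Fq)|(F1 & F2 & Fq)].
        -- apply Rle_trans with (Rabs (cp_t G S p - cp_t G S r)); [|rewrite Ep, Fq; rabs; lra].
           apply dist_spec; right; left.
           split; [congruence|]. split; [congruence|]. reflexivity.
        -- apply Rle_trans with (Rabs (cp_t G S p - (1 - cp_t G S r))); [|rewrite Ep, Fq; rabs; lra].
           apply dist_spec; right; right.
           split; [congruence|]. split; [congruence|]. reflexivity.
        -- apply Rle_trans with (Rabs (cp_t G S p - (1 - cp_t G S r))); [|rewrite Ep, Fq; rabs; lra].
           apply dist_spec; right; right.
           split; [congruence|]. split; [congruence|]. reflexivity.
        -- apply Rle_trans with (Rabs (cp_t G S p - cp_t G S r)); [|rewrite Ep, Fq; rabs; lra].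
           apply dist_spec; right; left.
           assert (E : cp_base G S p = cp_base G S r) by congruence.
           split; [assumption|]. split; [|reflexivity].
           apply (gcancel_l (cp_base G S r)). congruence.
Qed.

Lemma dist_same_edge p q : cp_base G S p = cp_base G S q -> cp_gen G S p = cp_gen G S q ->
  dist p q = Rabs (cp_t G S p - cp_t G S q).
Proof.
  intros E1 E2. apply Rle_antisym; [apply dist_spec; right; left; auto|].
  pose proof (cp_t_ok G S p). pose proof (cp_t_ok G S q).
  assert (H1 : wd (cp_base G S p) (cp_base G S p) = 0) by apply word_dist_refl.
  pose proof (word_dist_letter (cp_base G S p) _ (cp_gen_ok G S p)) as H2. pose proof H2 as H3.
  rewrite word_dist_sym in H3.
  destruct (proj1 (dist_spec p q)) as [(a & b & Ha & Hb & ->)|[(_ & _ & ->)|(F1 & F2 & ->)]].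
  - unfold cp_ends in Hb. rewrite <- E1, <- E2 in Hb.
    destruct Ha as [<-|[<-|[]]], Hb as [<-|[<-|[]]]; simpl;
      rewrite ?word_dist_refl, ?H2, ?H3; rabs; lra.
  - lra.
  - exfalso. destruct (cp_gen_ok G S q) as [Hne _]. apply Hne.
    apply (gmul_fixed (cp_base G S q)). congruence.
Qed.

Lemma zero_unit : 0 <= 0 <= 1.
Proof. lra. Qed.

Context {s0 : G} (Hs0 : letter s0).

(** A [cpoint] always lies on an edge, so representing vertices takes a letter; up to distance 0 its
    choice is immaterial. *)
Definition vtx (g : G) : point := CPoint G S g s0 0 Hs0 zero_unit.

Lemma dist_vtx p h : dist p (vtx h) =
  Rmin (cp_t G S p + wd (cp_base G S p) h)
       (1 - cp_t G S p + wd (gmul (cp_base G S p) (cp_gen G S p)) h).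
Proof.
  apply Rle_antisym.
  - apply Rmin_glb; apply dist_spec; left.
    + exists (cp_base G S p, cp_t G S p), (h, 0). simpl. split; [auto|split; [auto|lra]].
    + exists (gmul (cp_base G S p) (cp_gen G S p), 1 - cp_t G S p), (h, 0). simpl.
      split; [auto|split; [auto|lra]].
  - assert (Hm : forall a, In a (cp_ends G S p) -> Rmin (cp_t G S p + wd (cp_base G S p) h)
       (1 - cp_t G S p + wd (gmul (cp_base G S p) (cp_gen G S p)) h) <= snd a + wd (fst a) h).
    { intros a [<-|[<-|[]]]; simpl; [apply Rmin_l|apply Rmin_r]. }
    pose proof (cp_t_ok G S p).
    destruct (proj1 (dist_spec p (vtx h))) as [(a & b & Ha & Hb & ->)|[(E1 & E2 & ->)|(E1 & E2 & ->)]].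
    + eapply Rle_trans; [apply Hm, Ha|]. destruct Hb as [<-|[<-|[]]]; simpl; [lra|].
      pose proof (word_dist_tri (fst a) (gmul h s0) h).
      pose proof (word_dist_letter h s0 Hs0). rewrite word_dist_sym in H1. lra.
    + eapply Rle_trans; [apply Rmin_l|]. simpl in *. rewrite E1, word_dist_refl. rabs; lra.
    + eapply Rle_trans; [apply Rmin_r|]. simpl in *. rewrite E2, word_dist_refl. rabs; lra.
Qed.

Lemma dist_vtx_vtx g h : dist (vtx g) (vtx h) = wd g h.
Proof.
  rewrite dist_vtx. simpl. rewrite Rmin_left; [lra|].
  pose proof (word_dist_tri g (gmul g s0) h). pose proof (word_dist_letter g s0 Hs0). lra.
Qed.

Lemma dist_end p a : In a (cp_ends G S p) -> dist p (vtx (fst a)) = snd a.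
Proof.
  intro Ha. rewrite dist_vtx. pose proof (cp_t_ok G S p).
  pose proof (word_dist_letter (cp_base G S p) _ (cp_gen_ok G S p)) as H2. pose proof H2 as H3.
  rewrite word_dist_sym in H3.
  destruct Ha as [<-|[<-|[]]]; simpl; rewrite word_dist_refl, ?H2, ?H3;
    unfold Rmin; destruct (Rle_dec _ _); lra.
Qed.

Lemma dist_vtx_base p : dist p (vtx (cp_base G S p)) <= 1.
Proof.
  pose proof (dist_end p (cp_base G S p, cp_t G S p)). simpl in H. rewrite H by auto.
  apply (cp_t_ok G S p).
Qed.

Lemma is_vertex_dist g p : is_vertex G S g p -> dist p (vtx g) = 0.
Proof.
  intros [[<- E]|[<- E]].
  - pose proof (dist_end p (cp_base G S p, cp_t G S p)). simpl in H. rewrite H; auto.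
  - pose proof (dist_end p (gmul (cp_base G S p) (cp_gen G S p), 1 - cp_t G S p)).
    simpl in H. rewrite H; [lra|auto].
Qed.

Notation pm := cayley_pseudometric.

Lemma based_at_dist g (f : R -> point) : based_at G S g f <-> dist (f 0) (vtx g) = 0.
Proof.
  split.
  - intros (p & Hp & E). rewrite (pd_eq0_l pm _ _ _ E). apply is_vertex_dist, Hp.
  - intro E. exists (vtx g). split; [left; split; reflexivity|assumption].
Qed.

(** The distance is an integer plus the distance from [p] to an end of its edge, so the latter is 0
    or 1. Hence geodesics from a vertex are at vertices at integer times. *)
Lemma integer_dist_vertex p g n : dist p (vtx g) = INR n -> exists h, dist p (vtx h) = 0.
Proof.
  rewrite dist_vtx. pose proof (cp_t_ok G S p) as Ht. intro E.
  assert (Hint : forall a k, In a (cp_ends G S p) -> snd a + wd k g = INR n ->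
    0 <= snd a <= 1 -> snd a = 0 \/ snd a = 1).
  { intros a k Ha Hn Hb. destruct (word_dist_spec k g) as (w & _ & _ & Ew & _). rewrite Ew in Hn.
    assert (H : INR n - INR (length w) = snd a) by lra.
    destruct (Nat.lt_trichotomy n (length w)) as [Hl|[->|Hl]].
    - apply lt_INR in Hl. lra.
    - left; lra.
    - right. apply le_INR in Hl. rewrite S_INR in Hl. lra. }
  assert (Hex : forall a, In a (cp_ends G S p) -> snd a = 0 -> exists h, dist p (vtx h) = 0).
  { intros a Ha Ea. exists (fst a). rewrite dist_end; assumption. }
  set (a := (cp_base G S p, cp_t G S p)).
  set (b := (gmul (cp_base G S p) (cp_gen G S p), 1 - cp_t G S p)).
  assert (Ha : In a (cp_ends G S p)) by (left; reflexivity).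
  assert (Hb : In b (cp_ends G S p)) by (right; left; reflexivity).
  assert (H : snd a = 0 \/ snd b = 0).
  { unfold Rmin in E. destruct (Rle_dec _ _).
    - destruct (Hint a _ Ha E) as [H|H]; [simpl; lra|auto|right; simpl in *; lra].
    - destruct (Hint b _ Hb E) as [H|H]; [simpl; lra|auto|left; simpl in *; lra]. }
  destruct H; eauto.
Qed.

(** Makes a geodesic determined, up to distance 0, by its vertices. An interior point has [g] and
    [h] as the ends of its edge, in one of two orientations, and [dX] identifies these. *)
Lemma edge_unique g h z z' th : wd g h = 1 -> 0 <= th <= 1 ->
  dist z (vtx g) = th -> dist z (vtx h) = 1 - th ->
  dist z' (vtx g) = th -> dist z' (vtx h) = 1 - th -> dist z z' = 0.
Proof.
  intros Hgh Hth Hg Hh Hg' Hh'.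
  destruct (Req_dec th 0) as [->|H0].
  { rewrite (pd_eq0_l pm _ _ _ Hg), (pd_sym pm). assumption. }
  destruct (Req_dec th 1) as [->|H1].
  { rewrite Rminus_diag in Hh, Hh'. rewrite (pd_eq0_l pm _ _ _ Hh), (pd_sym pm). assumption. }
  assert (Hne : g <> h).
  { intros ->. rewrite word_dist_refl in Hgh. lra. }
  assert (Hedge : forall z, dist z (vtx g) = th -> dist z (vtx h) = 1 - th ->
    (cp_base G S z = g /\ gmul (cp_base G S z) (cp_gen G S z) = h /\ cp_t G S z = th) \/
    (cp_base G S z = h /\ gmul (cp_base G S z) (cp_gen G S z) = g /\ cp_t G S z = 1 - th)).
  { clear z z' Hg Hh Hg' Hh'. intros z. rewrite !dist_vtx.
    pose proof (cp_t_ok G S z) as Ht.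
    pose proof (word_dist_ge0 (cp_base G S z) g). pose proof (word_dist_ge0 (cp_base G S z) h).
    pose proof (word_dist_ge0 (gmul (cp_base G S z) (cp_gen G S z)) g).
    pose proof (word_dist_ge0 (gmul (cp_base G S z) (cp_gen G S z)) h).
    pose proof (word_dist_lt1 (cp_base G S z) g) as L1.
    pose proof (word_dist_lt1 (cp_base G S z) h) as L2.
    pose proof (word_dist_lt1 (gmul (cp_base G S z) (cp_gen G S z)) g) as L3.
    pose proof (word_dist_lt1 (gmul (cp_base G S z) (cp_gen G S z)) h) as L4.
    assert (Lz : forall x y, x = y -> wd x y = 0) by (intros x y ->; apply word_dist_refl).
    unfold Rmin. destruct (Rle_dec _ _), (Rle_dec _ _); intros A B.
    - exfalso. apply Hne. rewrite <- L1, <- L2 by lra. reflexivity.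
    - left. split; [apply L1; lra|]. split; [apply L4; lra|].
      rewrite Lz in A by (apply L1; lra). lra.
    - right. split; [apply L2; lra|]. split; [apply L3; lra|].
      rewrite Lz in A by (apply L3; lra). lra.
    - exfalso. apply Hne. rewrite <- L3, <- L4 by lra. reflexivity. }
  destruct (Hedge z Hg Hh) as [(E1 & E2 & E3)|(E1 & E2 & E3)],
    (Hedge z' Hg' Hh') as [(F1 & F2 & F3)|(F1 & F2 & F3)].
  1, 4: rewrite dist_same_edge;
    [rewrite E3, F3, Rminus_diag; apply Rabs_R0 | congruence
    |apply (gcancel_l (cp_base G S z)); congruence].
  all: apply Rle_antisym; [|apply (pd_ge0 pm)]; apply dist_spec; right; right;
    split; [congruence|split; [congruence|]]; rewrite E3, F3; symmetry;
    match goal with |- Rabs ?x = _ => replace x with 0 by lra end; apply Rabs_R0.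
Qed.

Lemma dist_translate g p q : dist (translate G S g p) (translate G S g q) = dist p q.
Proof.
  assert (Hle : forall g p q, dist (translate G S g p) (translate G S g q) <= dist p q).
  { clear g p q. intros g p q. apply dist_spec.
    destruct (proj1 (dist_spec p q)) as [(a & b & Ha & Hb & ->)|[(E1 & E2 & ->)|(E1 & E2 & ->)]].
    - left. exists (gmul g (fst a), snd a), (gmul g (fst b), snd b). simpl.
      rewrite word_dist_translate. rewrite <- !gmulA. split; [|split; [|reflexivity]].
      + destruct Ha as [<-|[<-|[]]]; auto.
      + destruct Hb as [<-|[<-|[]]]; auto.
    - right; left. simpl. rewrite E1. auto.
    - right; right. simpl. rewrite <- !gmulA, E2, <- E1. auto. }
  apply Rle_antisym; [apply Hle|].
  assert (E : forall p, translate G S (ginv g) (translate G S g p) = p).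
  { intros []. unfold translate. simpl. rewrite gmulVK. reflexivity. }
  pose proof (Hle (ginv g) (translate G S g p) (translate G S g q)). rewrite !E in H. assumption.
Qed.

Lemma translate_inv g p : translate G S g (translate G S (ginv g) p) = p.
Proof. destruct p. unfold translate. simpl. rewrite gmulK. reflexivity. Qed.

Lemma geodesic_same_edge p q : cp_base G S p = cp_base G S q -> cp_gen G S p = cp_gen G S q ->
  exists T, qpath dist 1 0 p q T.
Proof.
  assert (Hle : forall p q, cp_base G S p = cp_base G S q -> cp_gen G S p = cp_gen G S q ->
    cp_t G S p <= cp_t G S q -> exists T, qpath dist 1 0 p q T).
  { clear p q. intros p q E1 E2 Hpq.
    (* Clamping to the unit interval makes the path total, since a [cpoint] carries a proof of its
       range. *)
    assert (Hok : forall u, 0 <= Rmax 0 (Rmin 1 u) <= 1).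
    { intro u. split; [apply Rmax_l|]. apply Rmax_lub; [lra|apply Rmin_l]. }
    assert (Eok : forall u, 0 <= u <= 1 -> Rmax 0 (Rmin 1 u) = u).
    { intros u Hu. rewrite Rmin_right, Rmax_right; lra. }
    set (f := fun u => CPoint G S (cp_base G S p) (cp_gen G S p) (Rmax 0 (Rmin 1 u))
      (cp_gen_ok G S p) (Hok u)).
    pose proof (cp_t_ok G S p). pose proof (cp_t_ok G S q).
    exists (image dist f (cp_t G S p) (cp_t G S q)), f, (cp_t G S p), (cp_t G S q).
    split; [lra|]. split; [|split; [|split; [|auto using iff_refl]]].
    - apply (isom_qg (fun u => 0 <= u <= 1)).
      + intros s t Hs Ht. rewrite dist_same_edge by reflexivity. simpl. rewrite !Eok by lra.
        reflexivity.
      + intros; lra.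
    - rewrite dist_same_edge by reflexivity. simpl. rewrite Eok by lra.
      rewrite Rminus_diag. apply Rabs_R0.
    - rewrite dist_same_edge by assumption. simpl. rewrite Eok by lra.
      rewrite Rminus_diag. apply Rabs_R0. }
  intros E1 E2. destruct (Rle_dec (cp_t G S p) (cp_t G S q)).
  - auto.
  - destruct (Hle q p) as [T HT]; auto; [lra|]. exists T. apply qpath_sym, HT.
Qed.

Lemma geodesic_to_end p a : In a (cp_ends G S p) -> exists T, qpath dist 1 0 p (vtx (fst a)) T.
Proof.
  assert (H01 : 0 <= 1 <= 1) by lra.
  intros [<-|[<-|[]]].
  - destruct (geodesic_same_edge p (CPoint G S (cp_base G S p) (cp_gen G S p) 0
      (cp_gen_ok G S p) zero_unit)) as [T HT]; [reflexivity|reflexivity|].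
    exists T. eapply (qpath_endpoints pm); [exact HT|apply (pd_refl pm)|].
    apply is_vertex_dist. left. split; reflexivity.
  - destruct (geodesic_same_edge p (CPoint G S (cp_base G S p) (cp_gen G S p) 1
      (cp_gen_ok G S p) H01)) as [T HT]; [reflexivity|reflexivity|].
    exists T. eapply (qpath_endpoints pm); [exact HT|apply (pd_refl pm)|].
    apply is_vertex_dist. right. split; reflexivity.
Qed.

Lemma geodesic_vtx n g h : wd g h = INR n -> exists T, qpath dist 1 0 (vtx g) (vtx h) T.
Proof.
  revert g. induction n as [|n IH]; intros g Hn.
  - assert (g = h) as -> by (apply word_dist_lt1; rewrite Hn; simpl; lra).
    apply geodesic_same_edge; reflexivity.
  - destruct (word_dist_step g h n Hn) as (s & Hs & Hn').
    destruct (IH _ Hn') as [T2 HT2].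
    set (p := CPoint G S g s 0 Hs zero_unit).
    assert (Hp : dist p (vtx g) = 0) by (apply is_vertex_dist; left; split; reflexivity).
    destruct (geodesic_to_end p (gmul g s, 1 - 0)) as [T1 HT1]; [simpl; auto|].
    apply (geodesic_concat pm _ (vtx (gmul g s)) _ T1 T2).
    + eapply (qpath_endpoints pm); [exact HT1|assumption|apply (pd_refl pm)].
    + assumption.
    + rewrite !dist_vtx_vtx, Hn, Hn', word_dist_letter, S_INR by assumption. lra.
Qed.

(** The candidate attaining the minimum names the route; its pieces add up exactly, as
    [geodesic_concat] demands. *)
Lemma cayley_geodesic : geodesic_space dist.
Proof.
  intros p q.
  destruct (proj1 (dist_spec p q)) as [(a & b & Ha & Hb & E)|[(E1 & E2 & _)|(E1 & E2 & _)]].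
  - destruct (geodesic_to_end p a Ha) as [T1 HT1]. destruct (geodesic_to_end q b Hb) as [T3 HT3].
    apply qpath_sym in HT3. destruct (word_dist_spec (fst a) (fst b)) as (w & _ & _ & Ew & _).
    destruct (geodesic_vtx _ _ _ Ew) as [T2 HT2].
    pose proof (dist_end p a Ha) as Ea. pose proof (dist_end q b Hb) as Eb.
    rewrite (pd_sym pm) in Eb. pose proof (dist_vtx_vtx (fst a) (fst b)) as Eab.
    pose proof (pd_tri pm p (vtx (fst a)) q).
    pose proof (pd_tri pm (vtx (fst a)) (vtx (fst b)) q).
    destruct (geodesic_concat pm _ _ _ T2 T3 HT2 HT3) as [T HT]; [lra|].
    apply (geodesic_concat pm _ _ _ T1 T HT1 HT). lra.
  - apply geodesic_same_edge; assumption.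
  - assert (H : 0 <= 1 - cp_t G S p <= 1) by (pose proof (cp_t_ok G S p); lra).
    set (p' := CPoint G S (cp_base G S q) (cp_gen G S q) (1 - cp_t G S p) (cp_gen_ok G S q) H).
    destruct (geodesic_same_edge p' q) as [T HT]; [reflexivity|reflexivity|].
    exists T. eapply (qpath_endpoints pm); [exact HT| |apply (pd_refl pm)].
    rewrite (pd_sym pm). apply Rle_antisym; [|apply (pd_ge0 pm)].
    apply dist_spec. right; right. split; [assumption|]. split; [assumption|]. simpl.
    replace (cp_t G S p - (1 - (1 - cp_t G S p))) with 0 by lra. symmetry; apply Rabs_R0.
Qed.

(** * Limits of geodesics *)

Lemma indexed_dependent_choice {A : Type} (P : nat -> A -> Prop) (Q : nat -> A -> A -> Prop) (a0 : A) :
  P O a0 -> (forall n a, P n a -> exists b, P (Datatypes.S n) b /\ Q n a b) ->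
  exists f, f O = a0 /\ forall n, P n (f n) /\ Q n (f n) (f (Datatypes.S n)).
Proof.
  intros H0 Hstep.
  set (f := nat_rect (fun _ => A) a0
    (fun n a => epsilon (inhabits a0) (fun b => P (Datatypes.S n) b /\ Q n a b))).
  assert (Hs : forall n, P n (f n) -> P (Datatypes.S n) (f (Datatypes.S n)) /\
    Q n (f n) (f (Datatypes.S n))).
  { intros n Hn. apply (epsilon_spec (inhabits a0)
      (fun b => P (Datatypes.S n) b /\ Q n (f n) b)). auto. }
  assert (HP : forall n, P n (f n)) by (induction n; [assumption|apply Hs; assumption]).
  exists f. split; [reflexivity|]. intro n. split; [auto|apply Hs; auto].
Qed.

Lemma vertex_sequence_ray (v : nat -> G) :
  (forall n, exists s, letter s /\ v (Datatypes.S n) = gmul (v n) s) ->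
  (forall n, wd (v O) (v n) = INR n) ->
  exists h, isom_on dist ray h /\ (forall n, dist (h (INR n)) (vtx (v n)) = 0).
Proof.
  intros Hstep Hdist.
  assert (Hex : forall t, exists p : point, forall n, INR n <= t < INR n + 1 ->
    cp_base G S p = v n /\ gmul (v n) (cp_gen G S p) = v (Datatypes.S n) /\ cp_t G S p = t - INR n).
  { intro t. destruct (classic (0 <= t)) as [Ht|Ht].
    - destruct (nfloor_ex t Ht) as [n Hn]. destruct (Hstep n) as (s & Hs & Es).
      assert (Hok : 0 <= t - INR n <= 1) by lra.
      exists (CPoint G S (v n) s (t - INR n) Hs Hok). intros m Hm.
      assert (m = n) as ->; [|simpl; auto].
      destruct (Nat.lt_trichotomy m n) as [Hl|[->|Hl]]; [|reflexivity|];
        apply le_INR in Hl; rewrite S_INR in Hl; lra.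
    - exists (vtx (v O)). intros n Hn. pose proof (pos_INR n). lra. }
  destruct (functional_choice _ Hex) as [h Hh]. clear Hex.
  assert (Hlip : forall m k, wd (v k) (v (m + k)%nat) <= INR m).
  { induction m as [|m IH]; intro k; [simpl; rewrite word_dist_refl; lra|].
    rewrite S_INR. destruct (Hstep (m + k)%nat) as (s & Hs & Es).
    pose proof (word_dist_tri (v k) (v (m + k)%nat) (v (Datatypes.S (m + k)))).
    rewrite Es, word_dist_letter in H by assumption. specialize (IH k).
    replace (Datatypes.S m + k)%nat with (Datatypes.S (m + k)) by lia. rewrite Es. lra. }
  assert (Hends : forall t n, INR n <= t < INR n + 1 ->
    In (v n, t - INR n) (cp_ends G S (h t)) /\
    In (v (Datatypes.S n), INR n + 1 - t) (cp_ends G S (h t))).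
  { intros t n Hn. destruct (Hh t n Hn) as (E1 & E2 & E3). unfold cp_ends.
    rewrite E1, E2, E3. split; [left; reflexivity|]. right; left. f_equal. lra. }
  exists h. split.
  - assert (Hle : forall s t, 0 <= s <= t -> dist (h s) (h t) = t - s).
    { intros s t Hst. destruct (nfloor_ex s) as [i Hi]; [lra|].
      destruct (nfloor_ex t) as [j Hj]; [lra|].
      destruct (Hends s i Hi) as [Si Si']. destruct (Hends t j Hj) as [Tj Tj'].
      destruct (Nat.lt_trichotomy i j) as [Hl|[->|Hl]].
      - apply Rle_antisym.
        + apply Rle_trans with ((INR i + 1 - s) + wd (v (Datatypes.S i)) (v j) + (t - INR j)).
          * apply dist_spec. left. eexists _, _. split; [exact Si'|]. split; [exact Tj|]. reflexivity.
          * pose proof (Hlip (j - Datatypes.S i)%nat (Datatypes.S i)) as L.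
            replace (j - Datatypes.S i + Datatypes.S i)%nat with j in L by lia.
            rewrite minus_INR, S_INR in L by lia. lra.
        + pose proof (dist_end _ _ Si) as D1. pose proof (dist_end _ _ Tj') as D2.
          simpl in D1, D2. rewrite (pd_sym pm) in D1.
          pose proof (dist_vtx_vtx (v O) (v i)) as D3. rewrite Hdist in D3.
          pose proof (dist_vtx_vtx (v O) (v (Datatypes.S j))) as D4. rewrite Hdist, S_INR in D4.
          pose proof (pd_tri pm (vtx (v O)) (vtx (v i)) (h s)).
          pose proof (pd_tri pm (vtx (v O)) (h s) (vtx (v (Datatypes.S j)))).
          pose proof (pd_tri pm (h s) (h t) (vtx (v (Datatypes.S j)))). lra.
      - destruct (Hh s j Hi) as (E1 & E2 & E3). destruct (Hh t j Hj) as (F1 & F2 & F3).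
        rewrite dist_same_edge; [rewrite E3, F3; rabs; lra|congruence|].
        apply (gcancel_l (v j)). congruence.
      - apply le_INR in Hl. rewrite S_INR in Hl. lra. }
    intros s t Hs Ht. unfold ray in *. destruct (Rle_dec s t).
    + rewrite Hle by lra. rabs; lra.
    + rewrite (pd_sym pm), Hle by lra. rabs; lra.
  - intro n. destruct (Hends (INR n) n ltac:(lra)) as [E _]. apply dist_end in E. simpl in E.
    rewrite E. lra.
Qed.

Lemma big_pigeonhole {I T : Type} (Big : (I -> Prop) -> Prop) :
  (forall A B : I -> Prop, (forall i, A i -> B i) -> Big A -> Big B) ->
  (forall A B : I -> Prop, Big (fun i => A i \/ B i) -> Big A \/ Big B) ->
  (forall A, Big A -> exists i, A i) ->
  forall (l : list T) (P : T -> I -> Prop), Big (fun i => exists x, In x l /\ P x i) ->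
  exists x, In x l /\ Big (P x).
Proof.
  intros Hmono Hor Hne l P. induction l as [|x l IH]; intro HB.
  - destruct (Hne _ HB) as (i & x & [] & _).
  - destruct (Hor (P x) (fun i => exists y, In y l /\ P y i)) as [H|H].
    + revert HB. apply Hmono. intros i (y & [<-|Hy] & Hi); eauto.
    + exists x. split; [left; reflexivity|assumption].
    + destruct (IH H) as (y & Hy & HBy). exists y. split; [right; assumption|assumption].
Qed.

(** Koenig's lemma in Arzela-Ascoli form. [Big] is the complement of an ideal:
    "infinite" for extracting subsequences, "not finitely covered" for compactness. *)
Lemma limit_ray {I : Type} (Big : (I -> Prop) -> Prop) (ga : I -> R -> point) :
  (forall A B : I -> Prop, (forall i, A i -> B i) -> Big A -> Big B) ->
  (forall A B : I -> Prop, Big (fun i => A i \/ B i) -> Big A \/ Big B) ->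
  (forall A, Big A -> exists i, A i) ->
  (forall A (n : nat), Big A -> Big (fun i => A i /\ isom_on dist (fun s => 0 <= s <= INR n) (ga i))) ->
  Big (fun _ => True) -> (forall i, dist (ga i 0) (vtx gone) = 0) ->
  exists h, isom_on dist ray h /\ dist (h 0) (vtx gone) = 0 /\
    forall n, Big (fun i => forall s, 0 <= s <= INR n -> dist (ga i s) (h s) = 0).
Proof.
  intros Hmono Hor Hne Hext Hall Hbase.
  (* A state is a big subfamily together with the vertex at which all its members are at time n. *)
  set (P := fun n (st : (I -> Prop) * G) => Big (fst st) /\ forall i, fst st i ->
    isom_on dist (fun s => 0 <= s <= INR n) (ga i) /\ dist (ga i (INR n)) (vtx (snd st)) = 0).
  set (Q := fun (n : nat) (st st' : (I -> Prop) * G) => (forall i, fst st' i -> fst st i) /\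
    exists s, letter s /\ snd st' = gmul (snd st) s).
  set (A0 := fun i => True /\ isom_on dist (fun s => 0 <= s <= INR 0) (ga i)).
  destruct (indexed_dependent_choice P Q (A0, gone)) as (f & Hf0 & Hf).
  - split; simpl.
    + apply Hext, Hall.
    + intros i [_ Hi]. split; [assumption|apply Hbase].
  - intros n [A v] [HA Hi]. simpl in HA, Hi.
    set (A1 := fun i => A i /\ isom_on dist (fun s => 0 <= s <= INR (Datatypes.S n)) (ga i)).
    assert (HA1 : Big A1) by (apply Hext, HA).
    set (PS := fun s i => letter s /\ A1 i /\ dist (ga i (INR (Datatypes.S n))) (vtx (gmul v s)) = 0).
    (* The next vertex differs by one of finitely many letters, so some letter retains a big
       subfamily. *)
    destruct (big_pigeonhole Big Hmono Hor Hne (S ++ map ginv S) PS) as (s & _ & HPS).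
    { revert HA1. apply Hmono. intros i Ai. pose proof Ai as [Ai0 Hiso].
      destruct (Hi i Ai0) as [_ Hiv]. pose proof (pos_INR n).
      destruct (integer_dist_vertex (ga i (INR (Datatypes.S n))) gone (Datatypes.S n)) as [g Hg].
      { rewrite <- (pd_eq0_r pm _ _ _ (Hbase i)), Hiso by (rewrite S_INR; lra).
        rewrite S_INR. rabs; lra. }
      assert (E : wd v g = INR 1).
      { rewrite <- dist_vtx_vtx, <- (pd_eq0_l pm _ _ _ Hiv), <- (pd_eq0_r pm _ _ _ Hg).
        rewrite Hiso by (rewrite S_INR; lra). rewrite S_INR. simpl. rabs; lra. }
      destruct (word_dist_step v g O E) as (s & Hs & Es).
      assert (gmul v s = g) as Eg by (apply word_dist_lt1; rewrite Es; simpl; lra).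
      exists s. split.
      - apply in_or_app. destruct Hs as [_ [Hs|Hs]]; [left; assumption|right].
        apply in_map_iff. exists (ginv s). split; [apply ginvK|assumption].
      - split; [assumption|]. split; [exact Ai|]. rewrite Eg. assumption. }
    exists (PS s, gmul v s). split; [split|split]; simpl.
    + assumption.
    + intros i (_ & [_ Hiso] & E). auto.
    + intros i (_ & [Ai _] & _). assumption.
    + destruct (Hne _ HPS) as (i & Hs & _). eauto.
  - set (v := fun n => snd (f n)). set (A := fun n => fst (f n)).
    assert (Hdec : forall m n i, A (m + n)%nat i -> A n i).
    { induction m as [|m IH]; intros n i Hi; [assumption|].
      apply IH. apply (Hf (m + n)%nat). exact Hi. }
    assert (HA : forall n i, A n i -> forall k, (k <= n)%nat ->
      dist (ga i (INR k)) (vtx (v k)) = 0).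
    { intros n i Hi k Hk. apply (Hf k). apply (Hdec (n - k)%nat).
      replace (n - k + k)%nat with n by lia. assumption. }
    assert (Hv0 : v O = gone) by (unfold v; rewrite Hf0; reflexivity).
    destruct (vertex_sequence_ray v) as (h & Hh & Hhv).
    { intro n. apply (Hf n). }
    { intro n. destruct (Hf n) as [[HB Hn] _]. destruct (Hne _ HB) as (i & Hi).
      destruct (Hn i Hi) as [Hiso E]. pose proof (pos_INR n).
      rewrite Hv0, <- dist_vtx_vtx, <- (pd_eq0_r pm _ _ _ E), <- (pd_eq0_l pm _ _ _ (Hbase i)).
      rewrite Hiso by lra. rabs; lra. }
    exists h. split; [assumption|]. split.
    { rewrite <- Hv0. exact (Hhv O). }
    intro n. destruct (Hf n) as [[HB Hn] _]. revert HB. apply Hmono. intros i Hi s Hs.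
    destruct (Hn i Hi) as [Hiso _].
    destruct (nfloor_ex s) as [k Hk]; [lra|].
    assert (Hkn : (k <= n)%nat) by (apply INR_le; lra).
    pose proof (HA n i Hi k Hkn) as E1.
    destruct (Nat.eq_dec k n) as [->|Hne'].
    + assert (s = INR n) as -> by lra. rewrite (pd_eq0_l pm _ _ _ E1), (pd_sym pm). apply Hhv.
    + pose proof (HA n i Hi (Datatypes.S k) ltac:(lia)) as E2.
      assert (INR (Datatypes.S k) <= INR n) by (apply le_INR; lia).
      pose proof (Hhv k) as F1. pose proof (Hhv (Datatypes.S k)) as F2.
      rewrite S_INR in *. pose proof (pos_INR k).
      apply (edge_unique (v k) (v (Datatypes.S k)) _ _ (s - INR k)); try lra.
      * destruct (Hf k) as [_ [_ (a & Ha & Ea)]]. unfold v. rewrite Ea.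
        apply word_dist_letter, Ha.
      * rewrite <- (pd_eq0_r pm _ _ _ E1), Hiso by lra. rabs; lra.
      * rewrite <- (pd_eq0_r pm _ _ _ E2), Hiso by lra. rabs; lra.
      * rewrite <- (pd_eq0_r pm _ _ _ F1), Hh by (unfold ray; lra). rabs; lra.
      * rewrite <- (pd_eq0_r pm _ _ _ F2), Hh by (unfold ray; lra). rabs; lra.
Qed.

(** Boundary classes consist of rays at the basepoint, while translates start elsewhere. The new ray
    is a limit of geodesics from the basepoint to [a (INR n)]; moving their starts by [c] puts both
    ends on [a], so all stay within [N 1 (2 * c + 2)] of it, whatever n is. *)
Lemma asymptotic_ray_exists (N : R -> R -> R) (a : R -> point) :
  isom_on dist ray a -> Morse dist N ray a ->
  exists h, isom_on dist ray h /\ dist (h 0) (vtx gone) = 0 /\ asymptotic dist h a.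
Proof.
  intros Ha HM. set (c := dist (vtx gone) (a 0)).
  assert (Hc : 0 <= c) by apply (pd_ge0 pm).
  destruct (functional_choice (fun (n : nat) (g : R -> point) =>
    isom_on dist (fun s => 0 <= s <= dist (vtx gone) (a (INR n))) g /\
    dist (g 0) (vtx gone) = 0 /\ dist (g (dist (vtx gone) (a (INR n)))) (a (INR n)) = 0))
    as [ga Hga].
  { intro n. destruct (cayley_geodesic (vtx gone) (a (INR n))) as [T HT].
    destruct (geodesic_parametrize pm _ _ _ HT) as (g & H1 & H2 & H3 & _). eauto. }
  assert (Hlen : forall n, INR n - c <= dist (vtx gone) (a (INR n))).
  { intro n. pose proof (pd_tri pm (a 0) (vtx gone) (a (INR n))).
    pose proof (pos_INR n). rewrite (pd_sym pm (a 0) (vtx gone)) in H. fold c in H.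
    rewrite Ha in H by (unfold ray; lra). rewrite Rabs_minus_sym, Rabs_pos_eq in H; lra. }
  destruct (limit_ray (fun A : nat -> Prop => forall m, exists n, (m <= n)%nat /\ A n) ga)
    as (h & Hh & Hh0 & Hbig).
  - intros A B HAB HA m. destruct (HA m) as (n & Hn & An). eauto.
  - intros A B HAB. destruct (classic (forall m, exists n, (m <= n)%nat /\ A n)) as [H|H]; [auto|].
    right. apply not_all_ex_not in H. destruct H as [m0 Hm0]. intro m.
    destruct (HAB (m + m0)%nat) as (n & Hn & [An|Bn]).
    + exfalso. apply Hm0. exists n. split; [lia|assumption].
    + exists n. split; [lia|assumption].
  - intros A HA. destruct (HA O) as (n & _ & An). eauto.
  (* Big means infinite here; the n-th geodesic has length at least [INR n - c], so only finitely
     many are too short. *)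
  - intros A k HA m. destruct (INR_unbounded (INR k + c)) as [k' Hk'].
    destruct (HA (m + k')%nat) as (n & Hn & An). exists n. split; [lia|]. split; [assumption|].
    assert (INR k' <= INR n) by (apply le_INR; lia). specialize (Hlen n).
    intros s t Hs Ht. apply Hga; lra.
  - intro m. exists m. auto.
  - intro n. apply Hga.
  - exists h. split; [assumption|]. split; [assumption|].
    exists (N 1 (2 * c + 2)). intros s Hs.
    destruct (INR_unbounded s) as [m Hm]. destruct (INR_unbounded (s + c)) as [m' Hm'].
    destruct (Hbig m m') as (n & Hn & E). assert (INR m' <= INR n) by (apply le_INR; lia).
    specialize (E s ltac:(lra)). specialize (Hlen n).
    destruct (Hga n) as (G1 & G2 & G3). set (L := dist (vtx gone) (a (INR n))) in *.
    assert (HL : 0 <= L) by apply (pd_ge0 pm).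
    assert (HP : qpath dist 1 0 (vtx gone) (a (INR n)) (image dist (ga n) 0 L)).
    { exists (ga n), 0, L. split; [assumption|]. split; [|auto using iff_refl].
      eapply isom_qg; [exact G1|auto]. }
    destruct (qpath_move pm 1 0 c _ _ (a 0) (a (INR n)) _ ltac:(lra) ltac:(lra) HP)
      as (P' & HP' & SP & _).
    { unfold c. lra. }
    { rewrite (pd_refl pm). assumption. }
    replace (0 + 2 * c + 2) with (2 * c + 2) in HP' by lra.
    destruct (Morse_qpath pm N ray a 1 (2 * c + 2) 0 (INR n) (a 0) (a (INR n)) P' HM)
      with (z := h s) as (v & Hv & Hd); auto; try apply (pd_refl pm); try lra.
    + unfold ray; lra.
    + apply pos_INR.
    + apply SP. exists s. split; [lra|assumption].
    + exists v. auto.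
Qed.
(** * The Morse boundary *)

Lemma fin_hausdorff_asymptotic (g h : R -> point) :
  isom_on dist ray g -> isom_on dist ray h -> fin_hausdorff G S g h <-> asymptotic dist g h.
Proof.
  intros Hg Hh. split.
  - intros (K & H1 & _). exists K. exact H1.
  - intro Has. destruct (asymptotic_sym pm g h Hg Hh Has) as [K2 H2]. destruct Has as [K1 H1].
    exists (Rmax K1 K2). split.
    + intros s Hs. destruct (H1 s Hs) as (t & Ht & Hd). exists t. split; [assumption|].
      eapply Rle_trans; [exact Hd|apply Rmax_l].
    + intros t Ht. destruct (H2 t Ht) as (s & Hs & Hd). exists s. split; [assumption|].
      rewrite (pd_sym pm). eapply Rle_trans; [exact Hd|apply Rmax_r].
Qed.

Lemma asymptotic_refl (g : R -> point) : asymptotic dist g g.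
Proof. exists 0. intros s Hs. exists s. split; [assumption|]. rewrite (pd_refl pm). lra. Qed.

Lemma Morse_ray_isom g : Morse_ray G S g -> isom_on dist ray g.
Proof. intros (N & _ & Hg & _). exact Hg. Qed.

Lemma mclass_iff g h : Morse_ray G S g ->
  mclass G S g h <-> Morse_ray G S h /\ asymptotic dist g h.
Proof.
  intro Hg. unfold mclass. split; intros [Hh H]; split; try assumption;
    apply fin_hausdorff_asymptotic in H || apply fin_hausdorff_asymptotic;
    auto using Morse_ray_isom.
Qed.

Lemma mclass_refl g : Morse_ray G S g -> mclass G S g g.
Proof. intro Hg. apply mclass_iff; auto using asymptotic_refl. Qed.

Lemma mclass_eq g h : Morse_ray G S g -> Morse_ray G S h -> asymptotic dist g h ->
  mclass G S g = mclass G S h.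
Proof.
  intros Hg Hh Has. apply functional_extensionality. intro k. apply propositional_extensionality.
  rewrite !mclass_iff by assumption.
  pose proof (asymptotic_sym pm g h (Morse_ray_isom g Hg) (Morse_ray_isom h Hh) Has).
  split; intros [Hk H']; split; try assumption; eapply (asymptotic_trans pm); eauto.
Qed.

Lemma mclass_eq_asymptotic g h : Morse_ray G S g -> Morse_ray G S h ->
  mclass G S g = mclass G S h -> asymptotic dist g h.
Proof.
  intros Hg Hh E. apply mclass_iff; [assumption|]. rewrite E. apply mclass_refl. assumption.
Qed.

Lemma N_ray_Morse_ray N g : morse_gauge N -> N_ray G S N g -> Morse_ray G S g.
Proof. intros HN Hg. exists N. auto. Qed.

Lemma bdryN_iff N C : morse_gauge N ->
  bdryN G S N C <-> exists g, N_ray G S N g /\ C = mclass G S g.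
Proof.
  intro HN. split.
  - intros [(g0 & Hg0 & ->) (g & Hg & HNg)]. exists g. split; [assumption|].
    apply mclass_iff in Hg; [|assumption]. apply mclass_eq; tauto.
  - intros (g & Hg & ->). pose proof (N_ray_Morse_ray N g HN Hg) as HM. split.
    + exists g. auto.
    + exists g. split; [apply mclass_refl; assumption|assumption].
Qed.

(** The gauge inherited by a ray that starts within [c] of an [N]-Morse ray and is asymptotic to it.
    With [c = 0] it controls all rays of a class having one [N]-Morse ray. *)
Definition fellow_gauge (N : R -> R -> R) (c : R) : R -> R -> R :=
  let D := 2 * N 3 (3 + 2 * c) + 2 * c in fun lam eps => N lam (eps + 2 * D + 2) + D.

Lemma fellow_constant_ge0 N c : morse_gauge N -> 0 <= c -> 0 <= 2 * N 3 (3 + 2 * c) + 2 * c.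
Proof. intros HN Hc. pose proof (HN 3 (3 + 2 * c) ltac:(lra) ltac:(lra)). lra. Qed.

Lemma fellow_gauge_gauge N c : morse_gauge N -> 0 <= c -> morse_gauge (fellow_gauge N c).
Proof.
  intros HN Hc lam eps Hl He. unfold fellow_gauge.
  pose proof (fellow_constant_ge0 N c HN Hc).
  pose proof (HN lam (eps + 2 * (2 * N 3 (3 + 2 * c) + 2 * c) + 2) Hl ltac:(lra)). lra.
Qed.

Lemma asymptotic_Morse N c (al be : R -> point) : morse_gauge N -> 0 <= c ->
  isom_on dist ray al -> Morse dist N ray al -> isom_on dist ray be ->
  dist (be 0) (al 0) <= c -> asymptotic dist be al -> Morse dist (fellow_gauge N c) ray be.
Proof.
  intros HN Hc Hal HM Hbe H0 Has. apply (Morse_close pm N _ ray al be); auto.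
  - apply fellow_constant_ge0; assumption.
  - intros t Ht. apply (asymptotic_fellow pm N c); auto using cayley_geodesic.
Qed.

Lemma isom_translate x J (f : R -> point) :
  isom_on dist J f -> isom_on dist J (fun s => translate G S x (f s)).
Proof. intros Hf s t Hs Ht. rewrite dist_translate. auto. Qed.

Lemma Morse_translate x N J (f : R -> point) :
  Morse dist N J f -> Morse dist N J (fun s => translate G S x (f s)).
Proof.
  intros HM lam eps q a b s t Hl He Hab Hq Hs Ht Es Et u Hu.
  assert (E : forall p p', dist (translate G S (ginv x) p) p' = dist p (translate G S x p')).
  { intros p p'. rewrite <- (dist_translate x), translate_inv. reflexivity. }
  destruct (HM lam eps (fun v => translate G S (ginv x) (q v)) a b s t) with (u := u)
    as (v & Hv & Hd); auto.
  - intros v w Hv Hw. rewrite dist_translate. apply Hq; assumption.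
  - rewrite E. assumption.
  - rewrite E. assumption.
  - exists v. split; [assumption|]. rewrite <- E. assumption.
Qed.

Lemma bdry_act_bdry x C : bdry G S C -> bdry G S (bdry_act G S x C).
Proof.
  intros (g & Hg & ->). pose proof (Morse_ray_isom g Hg) as Ig.
  destruct Hg as (N & HN & Hg). set (xg := fun s => translate G S x (g s)).
  assert (Hxg : isom_on dist ray xg) by (apply isom_translate, Ig).
  assert (HM : Morse dist N ray xg) by (apply Morse_translate, Hg).
  destruct (asymptotic_ray_exists N xg Hxg HM) as (h & Hh & Hh0 & Has).
  set (c := dist (h 0) (xg 0)). assert (Hc : 0 <= c) by apply (pd_ge0 pm).
  assert (Hhm : Morse_ray G S h).
  { exists (fellow_gauge N c). split; [apply fellow_gauge_gauge; assumption|].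
    split; [exact Hh|]. split; [apply based_at_dist; assumption|].
    apply (asymptotic_Morse N c xg h); auto. unfold c; lra. }
  exists h. split; [assumption|].
  assert (Hgm : Morse_ray G S g) by (exists N; auto).
  apply functional_extensionality. intro k. apply propositional_extensionality.
  rewrite mclass_iff by assumption. unfold bdry_act. split.
  - intros (Hk & a & Ha & Hak). split; [assumption|].
    apply mclass_iff in Ha; [|assumption]. destruct Ha as [Ham Hga].
    apply fin_hausdorff_asymptotic in Hak;
      [|apply isom_translate, Morse_ray_isom, Ham|apply Morse_ray_isom, Hk].
    eapply (asymptotic_trans pm); [exact Has|]. eapply (asymptotic_trans pm); [|exact Hak].
    destruct Hga as [K HK]. exists K. intros s Hs. destruct (HK s Hs) as (t & Ht & Hd).
    exists t. split; [assumption|]. unfold xg. rewrite dist_translate. assumption.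
  - intros [Hk Hhk]. split; [assumption|]. exists g. split; [apply mclass_refl; assumption|].
    apply fin_hausdorff_asymptotic; auto using Morse_ray_isom.
    eapply (asymptotic_trans pm); [|exact Hhk].
    apply (asymptotic_sym pm); assumption.
Qed.

(** The [N]-Morse rays from the various vertices [x] towards the point are
    obtained from the orbit by translating a ray of [x^-1 p] back by [x]. *)
Lemma uniform_orbit_stable :
  (exists p, bdry G S p /\ exists N, morse_gauge N /\
     forall g : G, bdryN G S N (bdry_act G S g p)) -> qg_stable dist.
Proof.
  intros (p & (g & Hg & ->) & N & HN & Hp).
  pose proof (Morse_ray_isom g Hg) as Ig.
  assert (Hrays : forall x : G, exists al, isom_on dist ray al /\ Morse dist N ray al /\
    dist (vtx x) (al 0) = 0 /\ asymptotic dist g al).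
  { intro x. destruct (Hp (ginv x)) as [_ (h & (Hhm & a & Ha & Hah) & Hh & Hbase & HM)].
    apply mclass_iff in Ha; [|assumption]. destruct Ha as [Ham Hga].
    apply fin_hausdorff_asymptotic in Hah;
      [|apply isom_translate, Morse_ray_isom, Ham|exact Hh].
    exists (fun s => translate G S x (h s)).
    split; [apply isom_translate; exact Hh|]. split; [apply Morse_translate; exact HM|]. split.
    - assert (E : vtx x = translate G S x (vtx gone)).
      { unfold translate, vtx. simpl. rewrite gmulr1. reflexivity. }
      apply based_at_dist in Hbase. rewrite E, dist_translate, (pd_sym pm). assumption.
    - eapply (asymptotic_trans pm); [exact Hga|]. destruct Hah as [K HK]. exists K.
      intros s Hs. destruct (HK s Hs) as (t & Ht & Hd). exists t. split; [assumption|].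
      rewrite <- (dist_translate x), translate_inv in Hd. assumption. }
  intros lam eps Hl He.
  (* The slack is 1 because every point is within 1 of the base vertex of its edge. *)
  destruct (asymptotic_stable pm N 1 lam eps cayley_geodesic Hl He) as [D HD]; [|lra|].
  { apply HN; lra. }
  exists D. intros x y.
  destruct (Hrays (cp_base G S x)) as (al & Hal & Mal & Hal0 & Gal).
  destruct (Hrays (cp_base G S y)) as (be & Hbe & Mbe & Hbe0 & Gbe).
  apply (HD x y al be); auto.
  - apply (asymptotic_trans pm _ g); [|assumption]. apply (asymptotic_sym pm); assumption.
  - rewrite <- (pd_eq0_r pm _ _ _ Hal0). apply dist_vtx_base.
  - rewrite <- (pd_eq0_r pm _ _ _ Hbe0). apply dist_vtx_base.
Qed.

(** A given quasi-geodesic is bounded, so the points of [g] near it occur before the bound [M];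
    there [g] agrees with [h] for large n. The gauge passes to the limit unchanged. *)
Lemma limit_Morse N (h : R -> point) :
  (forall n, exists g, isom_on dist ray g /\ Morse dist N ray g /\
     forall s, 0 <= s <= INR n -> dist (g s) (h s) = 0) -> Morse dist N ray h.
Proof.
  intros Hlim lam eps q a b s t Hl He Hab Hq Hs Ht Es Et u Hu. unfold ray in *.
  set (M := s + lam * (b - a) + eps + N lam eps).
  destruct (INR_unbounded (Rmax M (Rmax s t))) as [n Hn].
  pose proof (Rmax_l M (Rmax s t)). pose proof (Rmax_r M (Rmax s t)).
  pose proof (Rmax_l s t). pose proof (Rmax_r s t).
  destruct (Hlim n) as (g & Hg & HM & Hgh).
  pose proof (Hgh s ltac:(lra)) as Gs. pose proof (Hgh t ltac:(lra)) as Gt.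
  destruct (HM lam eps q a b s t) with (u := u) as (v & Hv & Hd); auto.
  { rewrite (pd_eq0_r pm _ _ _ Gs). assumption. }
  { rewrite (pd_eq0_r pm _ _ _ Gt). assumption. }
  exists v. split; [assumption|].
  assert (Hvn : v <= INR n).
  { pose proof (pd_tri pm (g s) (q u) (g v)) as T1.
    rewrite (Hg s v), (pd_eq0_l pm _ _ _ Gs), <- (pd_eq0_l pm _ _ _ Es) in T1 by assumption.
    destruct (Hq a u ltac:(lra) Hu) as [_ U]. rewrite Rabs_minus_sym, Rabs_pos_eq in U by lra.
    assert (lam * (u - a) <= lam * (b - a)) by (apply Rmult_le_compat_l; lra).
    assert (v - s <= Rabs (s - v)) by (rabs; lra). unfold M in *. lra. }
  rewrite <- (pd_eq0_r pm _ _ _ (Hgh v ltac:(unfold ray in Hv; lra))). assumption.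
Qed.

(** With [Big] meaning that no finite subcover exists, the limit ray [h] agrees with a big set of
    rays on every bounded interval. The open set containing the class of [h] contains the classes of
    all [N]-rays agreeing with it long enough, so one set covers a big family, a contradiction. *)
Lemma uniform_gauge_compact :
  (exists N, morse_gauge N /\ forall C, bdry G S C -> bdryN G S N C) -> bdry_compact G S.
Proof.
  intros (N & HN & HC) I Us Hopen Hcov. apply NNPP. intro Hno.
  set (Big := fun A : {g | N_ray G S N g} -> Prop => forall l : list I,
    exists g, A g /\ forall i, In i l -> ~ Us i (mclass G S (proj1_sig g))).
  destruct (limit_ray Big (@proj1_sig _ _)) as (h & Hh & Hh0 & Hbig).
  - intros A B HAB HA l. destruct (HA l) as (g & Ag & Hg). eauto.
  - intros A B HAB. destruct (classic (Big A)) as [H|H]; [auto|]. right.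
    apply not_all_ex_not in H. destruct H as [l0 Hl0]. intro l.
    destruct (HAB (l ++ l0)) as (g & [Ag|Bg] & Hg).
    + exfalso. apply Hl0. exists g. split; [assumption|]. intros i Hi. apply Hg, in_or_app. auto.
    + exists g. split; [assumption|]. intros i Hi. apply Hg, in_or_app. auto.
  - intros A HA. destruct (HA nil) as (g & Ag & _). eauto.
  - intros A n HA l. destruct (HA l) as (g & Ag & Hg). exists g. split; [|assumption].
    split; [assumption|]. intros s t Hs Ht. apply (proj2_sig g); unfold ray_dom; lra.
  - intro l. apply NNPP. intro Hl. apply Hno. exists l. intros C HbC. apply NNPP. intro Hi.
    apply Hl. destruct (proj1 (bdryN_iff N C HN) (HC C HbC)) as (g & Hg & ->).
    exists (exist _ g Hg). split; [trivial|]. intros i Hin HU. apply Hi. eauto.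
  - intros [g Hg]. apply based_at_dist, Hg.
  - assert (Hlim : forall n, exists g, N_ray G S N g /\ forall s, 0 <= s <= INR n -> dist (g s) (h s) = 0).
    { intro n. destruct (Hbig n nil) as ([g Hg] & E & _). eauto. }
    assert (HhN : N_ray G S N h).
    { split; [exact Hh|]. split; [apply based_at_dist; assumption|]. apply limit_Morse.
      intro n. destruct (Hlim n) as (g & (H1 & H2 & H3) & E). eauto. }
    destruct (Hcov (mclass G S h)) as [i Hi].
    { exists h. split; [apply (N_ray_Morse_ray N); assumption|reflexivity]. }
    destruct (Hopen i N HN h HhN (conj HhN Hi)) as (T & del & Hdel & Hnear).
    destruct (INR_unbounded T) as [n Hn].
    destruct (Hbig n (i :: nil)) as ([g Hg] & E & HU). simpl in E, HU.
    apply (HU i); [auto|]. apply (Hnear g Hg). intros s Hs.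
    rewrite (pd_sym pm), E by lra. assumption.
Qed.

(** Otherwise [N]-rays of class [x] approximate [g] on arbitrarily long intervals. They all
    fellow-travel one fixed ray [h0] with a constant depending on [N] alone, so [g] is asymptotic to
    [h0]. *)
Lemma separated_from_class N x (g : R -> point) : morse_gauge N -> bdry G S x ->
  N_ray G S N g -> mclass G S g <> x ->
  exists T, forall h, N_ray G S N h -> (forall s, 0 <= s <= T -> dist (g s) (h s) < 1) ->
    mclass G S h <> x.
Proof.
  intros HN Hx Hg Hne. apply NNPP. intro Hno. apply Hne.
  assert (Hex : forall T, exists h, N_ray G S N h /\
    (forall s, 0 <= s <= T -> dist (g s) (h s) < 1) /\ mclass G S h = x).
  { intro T. apply NNPP. intro HT. apply Hno. exists T. intros h Hh Hcl E. apply HT. eauto. }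
  destruct (Hex 0) as (h0 & Hh0 & _ & E0). rewrite <- E0.
  pose proof (N_ray_Morse_ray N _ HN Hg) as Mg. pose proof (N_ray_Morse_ray N _ HN Hh0) as Mh0.
  apply mclass_eq; auto.
  exists (1 + (2 * N 3 (3 + 2 * 0) + 2 * 0)). intros s Hs. exists s. split; [assumption|].
  destruct (Hex s) as (h & Hh & Hcl & E). pose proof (N_ray_Morse_ray N _ HN Hh) as Mh.
  specialize (Hcl s ltac:(lra)). destruct Hh0 as (I0 & B0 & M0). destruct Hh as (I & B & M).
  apply based_at_dist in B0, B.
  assert (dist (h s) (h0 s) <= 2 * N 3 (3 + 2 * 0) + 2 * 0).
  { apply (asymptotic_fellow pm N 0 h0 h); auto using cayley_geodesic; try lra.
    - rewrite (pd_eq0_l pm _ _ _ B), (pd_sym pm), B0. lra.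
    - apply mclass_eq_asymptotic; auto. congruence. }
  pose proof (pd_tri pm (g s) (h s) (h0 s)). lra.
Qed.

(** Fixing one pair of constants allows a uniform gauge to be assembled pair by pair, and its
    failure to be located at a single pair. *)
Definition Morse_at (K lam eps : R) (g : R -> point) : Prop :=
  forall (q : R -> point) a b s t, a <= b -> qg dist lam eps q a b ->
    ray s -> ray t -> dist (q a) (g s) = 0 -> dist (q b) (g t) = 0 ->
    forall u, a <= u <= b -> exists v, ray v /\ dist (q u) (g v) <= K.

(** If the gauges are unbounded at some [(lam, eps)], a sequence of classes whose
    constants there tend to infinity meets every stratum in a finite set, so it
    is closed and discrete. *)
Lemma compact_uniform_gauge : bdry_compact G S ->
  exists N, morse_gauge N /\ forall C, bdry G S C -> bdryN G S N C.
Proof.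
  intro Hcomp.
  set (rep := fun C => epsilon (inhabits (fun _ : R => vtx gone))
    (fun g => Morse_ray G S g /\ C = mclass G S g)).
  assert (Hrep : forall C, bdry G S C -> Morse_ray G S (rep C) /\ C = mclass G S (rep C)).
  { intros C HC. apply epsilon_spec. exact HC. }
  destruct (classic (forall p : R * R, exists K, 0 <= K /\ (1 <= fst p -> 0 <= snd p ->
    forall C, bdry G S C -> Morse_at K (fst p) (snd p) (rep C)))) as [Hunif|Hunb].
  { destruct (functional_choice _ Hunif) as [N HN]. exists (fun lam eps => N (lam, eps)).
    assert (HG : morse_gauge (fun lam eps => N (lam, eps))).
    { intros lam eps _ _. apply HN. }
    split; [assumption|]. intros C HC. apply bdryN_iff; [assumption|].
    destruct (Hrep C HC) as [HM E]. exists (rep C). split; [|assumption].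
    destruct HM as (N' & _ & H1 & H2 & _). split; [assumption|]. split; [assumption|].
    intros lam eps q a b s t Hl He. exact (proj2 (HN (lam, eps)) Hl He C HC q a b s t). }
  exfalso. apply not_all_ex_not in Hunb. destruct Hunb as [[lam eps] Hunb]. simpl in Hunb.
  assert (Hl : 1 <= lam).
  { apply NNPP. intro H. apply Hunb. exists 0. split; [lra|]. intros; exfalso; auto. }
  assert (He : 0 <= eps).
  { apply NNPP. intro H. apply Hunb. exists 0. split; [lra|]. intros; exfalso; auto. }
  assert (Hx : forall n, exists C, bdry G S C /\ ~ Morse_at (INR n) lam eps (rep C)).
  { intro n. apply NNPP. intro H. apply Hunb. exists (INR n). split; [apply pos_INR|].
    intros _ _ C HC. apply NNPP. intro HM. apply H. eauto. }
  destruct (functional_choice _ Hx) as [x Hxn]. clear Hx Hunb.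
  (* If [x n] has an [N]-Morse ray, its representative is Morse for [fellow_gauge N 0], whose value
     at [(lam, eps)] is fixed while [INR n] grows. *)
  assert (Hfin : forall N, morse_gauge N -> exists n0, forall n, (n0 <= n)%nat ->
    ~ bdryN G S N (x n)).
  { intros N HN. destruct (INR_unbounded (fellow_gauge N 0 lam eps)) as [n0 Hn0].
    exists n0. intros n Hn Hb. destruct (Hxn n) as [Hbx HnM]. apply HnM.
    destruct (proj1 (bdryN_iff N _ HN) Hb) as (g & Hg & E). destruct (Hrep _ Hbx) as [HM E'].
    pose proof (N_ray_Morse_ray N g HN Hg) as Mg. destruct Hg as (Ig & Bg & NMg).
    assert (HF : Morse dist (fellow_gauge N 0) ray (rep (x n))).
    { apply (asymptotic_Morse N 0 g); auto using Morse_ray_isom; try lra.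
      - destruct HM as (N' & _ & _ & B & _). apply based_at_dist in B, Bg.
        rewrite (pd_eq0_l pm _ _ _ B), (pd_sym pm), Bg. lra.
      - apply mclass_eq_asymptotic; auto. congruence. }
    intros q a b s t Hab Hq Hs Ht Es Et u Hu.
    destruct (HF lam eps q a b s t Hl He Hab Hq Hs Ht Es Et u Hu) as (v & Hv & Hd).
    exists v. split; [assumption|]. apply le_INR in Hn. lra. }
  (* The k-th set omits the [x n] with [k <= n]. These sets increase, so a finite subcover would
     reduce to its largest index [K], which misses [x K]. Within a stratum only finitely many [x n]
     have to be avoided, which gives openness. *)
  destruct (Hcomp nat (fun k C => forall n, (k <= n)%nat -> C <> x n)) as [l Hcov].
  - intros k N HN g _ [Hg HU]. destruct (Hfin N HN) as [n0 Hn0].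
    assert (HT : exists T, forall n, (n < n0)%nat -> (k <= n)%nat -> forall h, N_ray G S N h ->
      (forall s, 0 <= s <= T -> dist (g s) (h s) < 1) -> mclass G S h <> x n).
    { clear Hn0. induction n0 as [|m [T IH]]; [exists 0; intros; lia|].
      destruct (Nat.le_gt_cases k m) as [Hkm|Hkm].
      - destruct (separated_from_class N (x m) g HN) as [T' HT']; auto.
        { apply Hxn. }
        exists (Rmax T T'). intros n Hn Hkn h Hh Hcl.
        pose proof (Rmax_l T T'). pose proof (Rmax_r T T').
        destruct (Nat.eq_dec n m) as [->|Hne].
        + apply HT'; [assumption|]. intros; apply Hcl; lra.
        + apply IH; try assumption; [lia|]. intros; apply Hcl; lra.
      - exists T. intros n Hn Hkn. lia. }
    destruct HT as [T HT]. exists T, 1. split; [lra|]. intros h Hh Hcl. split; [assumption|].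
    intros n Hkn. destruct (Nat.le_gt_cases n0 n) as [Hn|Hn].
    + intro E. apply (Hn0 n Hn). apply bdryN_iff; eauto.
    + apply HT; assumption.
  - intros C (g & (N & HN & Hg) & ->). destruct (Hfin N HN) as [n0 Hn0]. exists n0.
    intros n Hn E. apply (Hn0 n Hn). apply bdryN_iff; eauto.
  - set (K := list_max l). destruct (Hcov (x K)) as (i & Hi & HU); [apply Hxn|].
    apply (HU K); [|reflexivity].
    pose proof (proj1 (list_max_le l K) (le_n _)) as HF. rewrite Forall_forall in HF. auto.
Qed.

Lemma segments_Morse_rays N :
  (forall L g, geodesic_segment G S L g -> is_N_Morse G S N (seg_dom L) g) ->
  forall g, geodesic_ray G S g -> is_N_Morse G S N ray_dom g.
Proof.
  intros H g Hg. apply (Morse_of_segments pm N ray g).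
  - intros L h HL Hh. apply (H L h). split; assumption.
  - unfold ray; intros; lra.
  - exact Hg.
Qed.

End Cayley.

(** * Change of generating set, and the equivalences *)

Lemma letter_exists (G : group) (S S' : list G) (s : G) :
  generates G S' -> gen_letter G S s -> exists s', gen_letter G S' s'.
Proof.
  intros gen' [Hne _]. destruct (gen' s) as ([|s' w] & Hw & E).
  - exfalso. apply Hne. symmetry. exact E.
  - inversion_clear Hw. eauto.
Qed.

Lemma word_dist_lipschitz (G : group) (S S' : list G) : generates G S -> generates G S' ->
  exists K, 1 <= K /\ forall g h, word_dist G S' g h <= K * word_dist G S g h.
Proof.
  intros gen gen'.
  assert (HB : forall l : list G, exists K, 1 <= K /\
    forall s, In s l -> word_dist G S' gone s <= K).
  { induction l as [|s l (K & HK & IH)].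
    - exists 1. split; [lra|]. intros s [].
    - exists (Rmax K (word_dist G S' gone s)). pose proof (Rmax_l K (word_dist G S' gone s)).
      split; [lra|]. intros t [<-|Ht]; [apply Rmax_r|]. specialize (IH t Ht). lra. }
  destruct (HB (S ++ map ginv S)) as (K & HK & HKs). exists K. split; [assumption|].
  assert (Hw : forall w g, List.Forall (gen_letter G S) w ->
    word_dist G S' g (gmul g (wprod G w)) <= K * INR (length w)).
  { induction w as [|s w IH]; intros g Hw.
    - simpl. rewrite gmulr1, (word_dist_refl gen'). lra.
    - inversion_clear Hw. specialize (IH (gmul g s) H0). simpl wprod. rewrite gmulA.
      cbn [length]. rewrite S_INR.
      pose proof (word_dist_tri gen' g (gmul g s) (gmul (gmul g s) (wprod G w))).
      assert (word_dist G S' g (gmul g s) <= K).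
      { rewrite <- (gmulr1 g) at 1. rewrite (word_dist_translate gen'). apply HKs.
        apply in_or_app. destruct H as [_ [H|H]]; [left; assumption|right].
        apply in_map_iff. exists (ginv s). split; [apply ginvK|assumption]. }
      lra. }
  intros g h. destruct (word_dist_spec gen g h) as (w & Hl & <- & -> & _). auto.
Qed.

(** Points are sent to the base vertex of their edge, with an error of at most 2 in distances,
    whence [2 * K]. Two representations of one vertex may have different bases, so this map does not
    respect distance 0. *)
Lemma change_generators_stable (G : group) (S S' : list G) (s : G) :
  generates G S -> generates G S' -> gen_letter G S s ->
  qg_stable (dX G S') -> qg_stable (dX G S).
Proof.
  intros gen gen' Hs. destruct (letter_exists G S S' s gen' Hs) as [s' Hs'].
  destruct (word_dist_lipschitz G S S' gen gen') as (K1 & HK1 & L1).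
  destruct (word_dist_lipschitz G S' S gen' gen) as (K2 & HK2 & L2).
  set (K := Rmax K1 K2). pose proof (Rmax_l K1 K2) as M1. pose proof (Rmax_r K1 K2) as M2.
  fold K in M1, M2.
  assert (Hclose : forall p q, Rabs (dX G S p q -
    word_dist G S (cp_base G S p) (cp_base G S q)) <= 2).
  { intros p q. rewrite <- (dist_vtx_vtx gen Hs).
    pose proof (cayley_pseudometric gen) as pm.
    pose proof (dist_vtx_base gen Hs p) as Hp. pose proof (dist_vtx_base gen Hs q) as Hq.
    set (p' := vtx Hs (cp_base G S p)) in *. set (q' := vtx Hs (cp_base G S q)) in *.
    pose proof (pd_tri pm p p' q). pose proof (pd_tri pm p' q' q).
    pose proof (pd_tri pm p' p q'). pose proof (pd_tri pm p q q').
    rewrite (pd_sym pm q' q) in H0. rewrite (pd_sym pm p' p) in H1. rabs; lra. }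
  apply (qg_stable_quasi_isometry (dX G S) (dX G S')
    (fun p => vtx Hs' (cp_base G S p)) K (2 * K)); try lra.
  - apply cayley_pseudometric, gen.
  - apply cayley_pseudometric, gen'.
  - intros p q. rewrite (dist_vtx_vtx gen' Hs'). specialize (Hclose p q).
    specialize (L2 (cp_base G S p) (cp_base G S q)).
    pose proof (word_dist_ge0 gen' (cp_base G S p) (cp_base G S q)).
    assert (dX G S p q <= word_dist G S (cp_base G S p) (cp_base G S q) + 2)
      by (revert Hclose; rabs; lra).
    nra.
  - intros p q. rewrite (dist_vtx_vtx gen' Hs'). specialize (Hclose p q).
    specialize (L1 (cp_base G S p) (cp_base G S q)).
    pose proof (word_dist_ge0 gen (cp_base G S p) (cp_base G S q)).
    assert (word_dist G S (cp_base G S p) (cp_base G S q) <= dX G S p q + 2)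
      by (revert Hclose; rabs; lra).
    nra.
Qed.

Lemma cayley_hyperbolic_thin (G : group) (S : list G) : generates G S ->
  cayley_hyperbolic G S -> exists delta, 0 <= delta /\ thin_triangles (dX G S) delta.
Proof.
  intros gen (delta & Hdel & H). exists delta. split; [assumption|].
  pose proof (cayley_pseudometric gen) as pm.
  intros x y z A B C HA HB HC w Hw.
  destruct (geodesic_parametrize pm _ _ _ HA) as (al & A1 & A2 & A3 & A4).
  destruct (geodesic_parametrize pm _ _ _ HB) as (be & B1 & B2 & B3 & B4).
  destruct (geodesic_parametrize pm _ _ _ HC) as (ga & C1 & C2 & C3 & C4).
  apply A4 in Hw. destruct Hw as (u & Hu & Hw).
  destruct (H x y z (dX G S x y) (dX G S y z) (dX G S x z) al be ga) with (u := u)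
    as (v & [[Hv Hd]|[Hv Hd]]); auto;
    try (split; [apply (pd_ge0 pm)|assumption]).
  - exists (be v). split; [left; apply B4; exists v; split; [assumption|apply (pd_refl pm)]|].
    rewrite <- (pd_eq0_l pm _ _ _ Hw). assumption.
  - exists (ga v). split; [right; apply C4; exists v; split; [assumption|apply (pd_refl pm)]|].
    rewrite <- (pd_eq0_l pm _ _ _ Hw). assumption.
Qed.

Theorem theorem5p7 (G : group) (S : list G) :
  generates G S -> nonelementary_morse G S ->
  let P1 := hyperbolic_group G in
  let P2 := bdry_compact G S in
  let P3 := exists N, morse_gauge N /\ forall C, bdry G S C -> bdryN G S N C in
  let P4 := exists p, bdry G S p /\ exists N, morse_gauge N /\
              forall g : G, bdryN G S N (bdry_act G S g p) in
  let P5 := exists N, morse_gauge N /\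
              forall L g, geodesic_segment G S L g -> is_N_Morse G S N (seg_dom L) g in
  let P6 := exists N, morse_gauge N /\
              forall g, geodesic_ray G S g -> is_N_Morse G S N (ray_dom) g in
  (P1 <-> P2) /\ (P2 <-> P3) /\ (P3 <-> P4) /\ (P4 <-> P5) /\ (P5 <-> P6).
Proof.
  intros gen [(C0 & HC0) _] P1 P2 P3 P4 P5 P6.
  pose proof (cayley_pseudometric gen) as pm.
  (* A boundary class has a ray, a ray has points, and a point lies on an edge. *)
  assert (Hs : exists s, gen_letter G S s).
  { destruct HC0 as (g & _ & _). exists (cp_gen G S (g 0)). apply cp_gen_ok. }
  destruct Hs as [s Hs].
  assert (H1S : P1 -> qg_stable (dX G S)).
  { intros (S' & gen' & Hhyp). apply (change_generators_stable G S S' s); auto.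
    destruct (letter_exists G S S' s gen' Hs) as [s' Hs'].
    destruct (cayley_hyperbolic_thin G S' gen' Hhyp) as (delta & Hdel & Hthin).
    apply (hyperbolic_qg_stable (cayley_pseudometric gen') delta); auto.
    apply (cayley_geodesic gen' Hs'). }
  assert (HS5 : qg_stable (dX G S) -> P5).
  { intro HS. destruct (qg_stable_Morse pm HS) as (N & HN & HM). exists N.
    split; [assumption|]. intros L g [HL Hg]. apply HM; assumption. }
  assert (H51 : P5 -> P1).
  { intros (N & HN & HM). exists S. split; [assumption|]. exists (N 3 1).
    split; [apply HN; lra|]. intros x y z L1 L2 L3 al be ga [? ?] [? ?] [? ?].
    apply (Morse_segments_thin pm N (cayley_geodesic gen Hs)); auto.
    intros L g HL Hg. apply HM. split; assumption. }
  assert (H56 : P5 -> P6).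
  { intros (N & HN & HM). exists N. split; [assumption|]. apply segments_Morse_rays; assumption. }
  assert (H63 : P6 -> P3).
  { intros (N & HN & HM). exists N. split; [assumption|]. intros C (g & Hg & ->).
    apply (bdryN_iff gen N); [assumption|]. exists g. split; [|reflexivity].
    destruct Hg as (N' & _ & Hg & Hb & _). split; [assumption|]. split; [assumption|auto]. }
  assert (H34 : P3 -> P4).
  { intros (N & HN & HC). exists C0. split; [assumption|]. exists N. split; [assumption|].
    intro g. apply HC, (bdry_act_bdry gen Hs). assumption. }
  assert (H4S : P4 -> qg_stable (dX G S)) by apply (uniform_orbit_stable gen Hs).
  assert (H32 : P3 -> P2) by apply (uniform_gauge_compact gen Hs).
  assert (H23 : P2 -> P3) by apply (compact_uniform_gauge gen Hs).
  (* The implications form the cycle [P1], stability, [P5], [P1] and the cycle [P5], [P6], [P3],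
     [P4], stability, [P5], with [P2] attached to [P3]. *)
  clearbody P1 P2 P3 P4 P5 P6. tauto.
Qed.
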